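(* Let $\rho\in(0,1)$, $\alpha\in(0,1)$ and let $k\ge1$ be a fixed integer. Let $X_1,X_2,\dots$ be jointly Gaussian with $X_i\sim N(\mu_i,1)$, $\mu_i\ge0$, and $\operatorname{Corr}(X_i,X_j)=\rho$ for all $i\ne j$. For each $n\ge2$ let $\mathcal I_0=\{i\le n:\mu_i=0\}$, $n_0=|\mathcal I_0|$, and $$c_n(\alpha,\rho)=\sqrt{1-\rho}\,\Phi^{-1}\!\left(1-\tfrac1n\right)-\sqrt{\rho}\,\Phi^{-1}(\alpha).$$ Suppose $\lim_{n\to\infty}\frac{n_0}{n}>0$. Then the procedure that rejects $\mathrm{H}_{0i}$ whenever $X_i>c_n(\alpha,\rho)$ is asymptotically exact with respect to $k$-FWER control, i.e. $$\lim_{n\to\infty}k\text{-}\mathrm{FWER}^{I}(n,\alpha,\rho)=\alpha.$$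
   Context: $\Phi$ is the standard normal distribution function. For each $n$ one tests $\mathrm{H}_{0i}:\mu_i=0$ versus $\mathrm{H}_{1i}:\mu_i>0$, $i=1,\dots,n$; $\mathcal I_0$ is the index set of true nulls. The $k$-FWER of a procedure is the probability that it rejects at least $k$ true null hypotheses; thus $k\text{-}\mathrm{FWER}^{I}(n,\alpha,\rho)=\mathbb{P}\big(|\{i\in\mathcal I_0: X_i>c_n(\alpha,\rho)\}|\ge k\big)$. *)

(* Defs.v *)
From HB Require Import structures.
From mathcomp Require Import all_boot all_order all_algebra.
From mathcomp Require Import all_classical all_reals all_analysis.

Set Implicit Arguments.
Unset Strict Implicit.
Unset Printing Implicit Defensive.

Import Order.TTheory GRing.Theory Num.Theory.
Import numFieldNormedType.Exports.

Local Open Scope classical_set_scope.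
Local Open Scope ring_scope.

Definition Phi {R : realType} (x : R) : R := fine (normal_prob 0 1 `]-oo, x]).

(* [Phi] is a bijection from [R] onto ]0, 1[; outside ]0, 1[ the value is an
   arbitrary default. *)
Definition Phi_inv {R : realType} (p : R) : R := get [set x : R | Phi x = p].

(* Normal law with mean [m] and standard deviation [s], with the convention
   N(m, 0) = Dirac mass at [m]. The library's [normal_prob m 0] is the uniform
   law on [0, 1] instead. *)
Definition gaussian_law {R : realType} (m s : R) (A : set R) : \bar R :=
  if s == 0 then \d_m A else normal_prob m s A.

Section Gaussian.
Context d (T : measurableType d) (R : realType) (P : probability T R).

Definition has_gaussian_law (m s : R) (Y : T -> R) : Prop :=
  forall A : set R, measurable A -> pushforward P Y A = gaussian_law m s A.

(* Every finite linear combination is univariate Gaussian, possibly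
   degenerate. *)
Definition jointly_gaussian (X : nat -> {RV P >-> R}) : Prop :=
  forall (n : nat) (a : 'I_n -> R), exists m s : R,
    0 <= s /\ has_gaussian_law m s (fun w => \sum_(i < n) a i * X i w).

Definition correlation (X Y : {RV P >-> R}) : R :=
  fine (covariance P X Y)
  / (Num.sqrt (fine 'V_P[X]) * Num.sqrt (fine 'V_P[Y])).

Definition kFWER (k n : nat) (I0 : {set 'I_n}) (rejected : T -> {set 'I_n}) :
    \bar R :=
  P [set w | (k <= #|I0 :&: rejected w|)%N].

(* The hypotheses 1, ..., n are indexed by 'I_n, so [X i] is the paper's
   X_{i+1}. *)
Definition threshold_procedure (X : nat -> {RV P >-> R}) (n : nat) (c : R)
    (w : T) : {set 'I_n} :=
  [set i : 'I_n | c < X i w]%SET.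

End Gaussian.

Definition true_nulls {R : realType} (mu : nat -> R) (n : nat) : {set 'I_n} :=
  [set i : 'I_n | mu i == 0]%SET.

Definition cutoff {R : realType} (n : nat) (alpha rho : R) : R :=
  Num.sqrt (1 - rho) * Phi_inv (1 - n%:R^-1) - Num.sqrt rho * Phi_inv alpha.

(* Main.v *)
Require Import Defs.
From HB Require Import structures.
From mathcomp Require Import all_boot all_order all_algebra.
From mathcomp Require Import all_classical all_reals all_analysis.
From mathcomp Require Import measurable_realfun ring lra.

(** Put z = Phi^-1(alpha), q_n = Phi^-1(1 - 1/n) and let m be the number of true
    nulls. Let U be minus the standardised mean of the null X_i. For a suitable
    tau, tending to sqrt rho, the variables Z_i = (X_i + tau U) / sqrt (1 - rho)
    are standard normal and pairwise uncorrelated, hence pairwise independent,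
    and X_i > c_n reads sqrt (1 - rho) (Z_i - q_n) > tau U - sqrt rho z.
    No independence of U and the Z_i is needed:
    - by a union bound, all Z_i are below q_n + e outside an event of
      probability m (1 - Phi (q_n + e)), which tends to 0;
    - by Chebyshev's inequality, at least k of the Z_i are above q_n - e outside
      an event of probability of order 1 / (m (1 - Phi (q_n - e))), which
      tends to 0.
    Hence k-FWER is within o(1) of P (tau U <= sqrt rho z +- sqrt (1 - rho) e),
    which is close to Phi z = alpha.

    Pairwise independence is obtained from the characteristic function: it gives
    E[f(Z_i) g(Z_j)] = E f(Z_i) E g(Z_j) for trigonometric polynomials, which
    approximate the indicators of half-lines pointwise and boundedly. *)

Set Implicit Arguments.
Unset Strict Implicit.
Unset Printing Implicit Defensive.

Import Order.TTheory GRing.Theory Num.Theory.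
Import numFieldNormedType.Exports.

Local Open Scope classical_set_scope.
Local Open Scope ring_scope.

(** * Moments and characteristic function of the normal law *)

Section normal_prob_integral.
Context {R : realType}.
Notation mu := (@lebesgue_measure R).

(** The abstract derivative and the explicit density have the same integral over every measurable
    set, hence agree almost everywhere. Change of variables then holds with the explicit density. *)
Lemma Radon_Nikodym_normal_prob (m s : R) :
  ae_eq mu setT (fun x => (normal_pdf m s x)%:E)
    (Radon_Nikodym_SigmaFinite.f (normal_prob m s) mu).
Proof.
have dom := @normal_prob_dominates R m s.
apply: integral_ae_eq => //=.
- exact: integrable_normal_pdf.
- exact: measurable_int (Radon_Nikodym_SigmaFinite.f_integrable dom).
- by move=> E _ mE; rewrite -Radon_Nikodym_SigmaFinite.f_integral.
Qed.

Lemma ge0_integral_normal_prob (m s : R) (f : R -> R) :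
  measurable_fun setT f -> (forall x, 0 <= f x) ->
  (\int[normal_prob m s]_x (f x)%:E =
   \int[mu]_x (f x * normal_pdf m s x)%:E)%E.
Proof.
move=> mf f0; have dom := @normal_prob_dominates R m s.
have mf' : measurable_fun setT (fun x => (f x)%:E) by exact/measurable_EFinP.
rewrite -(Radon_Nikodym_SigmaFinite.change_of_variables dom) //.
apply: ae_eq_integral => //.
- apply: emeasurable_funM => //.
  exact: measurable_int (Radon_Nikodym_SigmaFinite.f_integrable dom).
- apply/measurable_EFinP/measurable_funM => //; exact: measurable_normal_pdf.
- apply: filterS (Radon_Nikodym_normal_prob m s) => x /(_ I) pdfE _.
  by rewrite EFinM pdfE.
Qed.

Lemma integral_normal_prob (m s : R) (f : R -> R) :
  measurable_fun setT f ->
  mu.-integrable setT (fun x => (f x * normal_pdf m s x)%:E) ->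
  (normal_prob m s).-integrable setT (EFin \o f) /\
  (\int[normal_prob m s]_x (f x)%:E =
   \int[mu]_x (f x * normal_pdf m s x)%:E)%E.
Proof.
move=> mf intf; have dom := @normal_prob_dominates R m s.
have intf' : (normal_prob m s).-integrable setT (EFin \o f).
  apply/integrableP; split; first exact/measurable_EFinP.
  rewrite [ltLHS](_ : _ = \int[normal_prob m s]_x (`|f x|)%:E)%E //.
  rewrite ge0_integral_normal_prob//; last exact: measurableT_comp.
  case/integrableP: intf => _; congr (_ < _)%E; apply: eq_integral => x _.
  by rewrite /= normrM (ger0_norm (normal_pdf_ge0 _ _ _)).
(* The signed case reduces to the nonnegative one through f = (f + |f|) - |f|. *)
split => //; pose g x := f x + `|f x|.
have mnf : measurable_fun setT (fun x => `|f x|) by exact: measurableT_comp.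
have g0 x : 0 <= g x.
  by rewrite -lerBlDl sub0r; have := ler_norm (- f x); rewrite normrN.
have mg : measurable_fun setT g by exact: measurable_funD.
have intnf : (normal_prob m s).-integrable setT (EFin \o (fun x => `|f x|)).
  exact: (integrable_abse intf').
have intng : (normal_prob m s).-integrable setT (EFin \o g).
  exact: (integrableD measurableT intf' intnf).
have intnfp : mu.-integrable setT (fun x => (`|f x| * normal_pdf m s x)%:E).
  apply: eq_integrable (integrable_abse intf) => //= x _.
  by rewrite normrM (ger0_norm (normal_pdf_ge0 _ _ _)).
have intgp : mu.-integrable setT (fun x => (g x * normal_pdf m s x)%:E).
  apply: eq_integrable (integrableD measurableT intf intnfp) => //= x _.
  by rewrite /g mulrDl EFinD.
transitivity (\int[normal_prob m s]_x ((g x)%:E - (`|f x|)%:E))%E.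
  by apply: eq_integral => x _; rewrite -EFinB /g addrK.
rewrite (integralB measurableT intng intnf) !ge0_integral_normal_prob//.
rewrite -(integralB measurableT intgp intnfp).
by apply: eq_integral => x _; rewrite -EFinB -mulrBl /g addrK.
Qed.

End normal_prob_integral.

Section whole_line_FTC.
Context {R : realType}.
Notation mu := (@lebesgue_measure R).

(** The fundamental theorem of calculus on growing symmetric intervals, followed by dominated
    convergence with bound |f|. Applied to products with the normal density, it serves as
    integration by parts on the line. *)
Lemma integral_derivative_vanishing (F f : R -> R) :
  (forall x : R, is_derive x 1 F (f x)) -> continuous f ->
  mu.-integrable setT (EFin \o f) ->
  F n%:R @[n --> \oo] --> 0 -> F (- n%:R) @[n --> \oo] --> 0 ->
  (\int[mu]_x (f x)%:E = 0)%E.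
Proof.
move=> dF cf intf F0 FN0.
have mf : measurable_fun setT f by exact: continuous_measurable_fun.
(* The shift to [n.+1] keeps the interval nondegenerate at n = 0. *)
pose f_ n := (EFin \o f) \_ `[- n.+1%:R, n.+1%:R].
have itvE n : (\int[mu]_x f_ n x = (F n.+1%:R - F (- n.+1%:R))%:E)%E.
  rewrite -integral_mkcond EFinB; apply: continuous_FTC2 => //.
  - by have := ltr0Sn R n; lra.
  - exact: continuous_subspaceT.
  - have cF : continuous F.
      by move=> x; apply/differentiable_continuous/derivable1_diffP.
    by split => // [|]; [apply: cvg_at_right_filter|apply: cvg_at_left_filter];
      exact: cF.
  - by move=> x _; rewrite derive1E derive_val.
have l0 : (\int[mu]_x f_ n x)%E @[n --> \oo] --> 0%:E.
  under eq_fun do rewrite itvE.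
  apply: cvg_EFin; first exact: nearW.
  rewrite /comp /= -[X in _ --> X](subr0 0); apply: cvgB.
    by rewrite (cvg_shiftS (fun n => F n%:R)).
  by rewrite (cvg_shiftS (fun n => F (- n%:R))).
have l1 : (\int[mu]_x f_ n x)%E @[n --> \oo] --> (\int[mu]_x (f x)%:E)%E.
  apply: (@dominated_cvg _ _ _ mu _ measurableT f_ _
    (fun x => (`|f x|)%:E)) => //.
  - move=> n; apply/(measurable_restrictT _ _).1 => //.
    exact/measurable_EFinP/measurable_funTS.
  - move=> x _; apply: cvg_near_cst.
    near=> n; rewrite /f_ patchE mem_set//=.
    rewrite in_itv/= -ler_norml.
    near: n; exists (Num.truncn `|x|) => // n /= xn.
    by rewrite ltW// (lt_le_trans (truncnS_gt _))// ler_nat ltnS.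
  - exact: (integrable_abse intf).
  - move=> n x _; rewrite /f_ patchE; case: ifP => _ //=.
    by rewrite normr0 lee_fin.
by rewrite -(cvg_lim _ l1)//; apply: cvg_lim.
Unshelve. all: end_near. Qed.

End whole_line_FTC.

Section normal_moments.
Context {R : realType}.
Notation mu := (@lebesgue_measure R).
Variables (m s : R).
Hypothesis s_neq0 : s != 0.
Notation phi := (normal_pdf m s).

Lemma is_derive_normal_pdf (x : R) :
  is_derive x 1 phi (- ((x - m) / s ^+ 2) * phi x).
Proof.
rewrite normal_pdfE // /normal_fun.
apply: is_derive_eq.
by rewrite /GRing.scale /=; field; exact: s_neq0.
Qed.

(** With y = (x - m)^2 / (4 s^2) the density is proportional to exp (- y) * exp (- y). One factor
    absorbs the square, as y exp (- y) <= 1, and the other is the shape of the density of doubled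
    variance. This gives both integrability and decay at infinity. *)
Lemma sqr_mul_normal_pdf_le : exists K : R, forall x : R,
  (x - m) ^+ 2 * phi x <= K * normal_pdf m (Num.sqrt 2 * s) x.
Proof.
have s2_neq0 : Num.sqrt 2 * s != 0 by rewrite mulf_neq0// sqrtr_eq0 -ltNge.
exists (4 * s ^+ 2 * (normal_peak s / normal_peak (Num.sqrt 2 * s))) => x.
have p2 := normal_peak_gt0 s2_neq0.
have p1 := normal_peak_gt0 s_neq0.
rewrite !normal_pdfE// /normal_fun.
pose y := (x - m) ^+ 2 / (4 * s ^+ 2).
have y0 : 0 <= y by rewrite divr_ge0 ?sqr_ge0// mulr_ge0 ?sqr_ge0.
have -> : - (x - m) ^+ 2 / (s ^+ 2 *+ 2) = - y + - y.
  by rewrite /y; field; exact: s_neq0.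
have -> : - (x - m) ^+ 2 / ((Num.sqrt 2 * s) ^+ 2 *+ 2) = - y.
  by rewrite /y exprMn sqr_sqrtr//; field; exact: s_neq0.
have -> : (x - m) ^+ 2 = 4 * s ^+ 2 * y.
  by rewrite /y; field; exact: s_neq0.
rewrite expRD.
have ye : y * expR (- y) <= 1.
  rewrite expRN ler_pdivrMr ?expR_gt0// mul1r (le_trans _ (expR_ge1Dx y))//; lra.
set e := expR _ in ye *.
have -> : 4 * s ^+ 2 * (normal_peak s / normal_peak (Num.sqrt 2 * s)) *
    (normal_peak (Num.sqrt 2 * s) * e) = (4 * s ^+ 2 * normal_peak s * e) * 1.
  by field; rewrite gt_eqF.
have -> : 4 * s ^+ 2 * y * (normal_peak s * (e * e)) =
    (4 * s ^+ 2 * normal_peak s * e) * (y * e) by ring.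
apply: ler_wpM2l => //.
by rewrite mulr_ge0 ?expR_ge0// mulr_ge0 ?(ltW p1)// mulr_ge0 ?sqr_ge0.
Qed.

Lemma integrable_sqr_normal_pdf :
  mu.-integrable setT (fun x => ((x - m) ^+ 2 * phi x)%:E).
Proof.
have [K Kb] := sqr_mul_normal_pdf_le.
have intK : mu.-integrable setT
    (fun x => (K%:E * (normal_pdf m (Num.sqrt 2 * s) x)%:E)%E).
  by apply: integrableZl => //; exact: integrable_normal_pdf.
apply: (le_integrable measurableT _ _ intK).
  apply/measurable_EFinP/measurable_funM; last exact: measurable_normal_pdf.
  by apply/measurable_funX/measurable_funB.
move=> x _.
have q0 : 0 <= (x - m) ^+ 2 * phi x.
  exact: mulr_ge0 (sqr_ge0 _) (normal_pdf_ge0 _ _ _).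
rewrite -EFinM lee_fin (ger0_norm q0); exact: le_trans (Kb x) (ler_norm _).
Qed.

Lemma integrable_center_normal_pdf :
  mu.-integrable setT (fun x => ((x - m) * phi x)%:E).
Proof.
apply: (le_integrable measurableT _ _
  (integrableD measurableT (@integrable_normal_pdf R m s) integrable_sqr_normal_pdf)).
  apply/measurable_EFinP/measurable_funM; last exact: measurable_normal_pdf.
  exact: measurable_funB.
move=> x _; rewrite -EFinD lee_fin normrM (ger0_norm (normal_pdf_ge0 _ _ _)).
rewrite -{2}(mul1r (phi x)) -mulrDl (le_trans _ (ler_norm _))//.
rewrite ler_wpM2r ?normal_pdf_ge0//.
rewrite -real_normK ?num_real//; have := normr_ge0 (x - m); nra.
Qed.

(** A bound C on (x - m)^2 phi x gives |x - m| phi x <= C / |x - m|. *)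
Lemma center_normal_pdf_cvg0 (u : nat -> R) :
  `|u n - m| @[n --> \oo] --> +oo ->
  (u n - m) * phi (u n) @[n --> \oo] --> 0.
Proof.
move=> uoo; have [K Kb] := sqr_mul_normal_pdf_le.
have s2_neq0 : Num.sqrt 2 * s != 0 by rewrite mulf_neq0// sqrtr_eq0 -ltNge.
pose C := `|K| * normal_peak (Num.sqrt 2 * s).
have Cb x : (x - m) ^+ 2 * phi x <= C.
  apply: le_trans (Kb x) _; apply: le_trans (ler_norm _) _.
  rewrite normrM ler_wpM2l// ger0_norm ?normal_pdf_ge0//.
  exact: normal_pdf_ub.
apply: norm_cvg0.
apply: (@squeeze_cvgr _ _ _ _ (fun=> 0) (fun n => C * `|u n - m|^-1)).
- near=> n; rewrite normr_ge0/= normrM (ger0_norm (normal_pdf_ge0 _ _ _)).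
  have un0 : 0 < `|u n - m| by near: n; exact: cvgry_gt.
  by rewrite ler_pdivlMr// mulrAC -expr2 real_normK ?num_real.
- exact: cvg_cst.
- rewrite -[X in _ --> X](mulr0 C); apply: cvgMr.
  apply/gtr0_cvgV0 => //.
  by near=> n; near: n; exact: cvgry_gt.
Unshelve. all: end_near. Qed.

Lemma normal_pdf_cvg0 (u : nat -> R) :
  `|u n - m| @[n --> \oo] --> +oo -> phi (u n) @[n --> \oo] --> 0.
Proof.
move=> uoo; have /cvgr0_norm_le cu := center_normal_pdf_cvg0 uoo.
apply/cvgr0Pnorm_le => e e0; near=> n.
have un1 : 1 <= `|u n - m| by near: n; exact: cvgry_ge.
apply: (@le_trans _ _ `|(u n - m) * phi (u n)|); last by near: n; exact: cu.
by rewrite normrM ler_peMl.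
Unshelve. all: end_near. Qed.

Lemma normr_natB_cvgy : `|n%:R - m| @[n --> \oo] --> +oo.
Proof.
apply/cvgryPge => A; near=> n.
apply: le_trans (ler_norm _); rewrite lerBrDr.
by near: n; exact: nbhs_infty_ger.
Unshelve. all: end_near. Qed.

Lemma normr_oppnatB_cvgy : `|- n%:R - m| @[n --> \oo] --> +oo.
Proof.
apply/cvgryPge => A; near=> n.
rewrite -normrN; apply: le_trans (ler_norm _); rewrite opprD !opprK -lerBlDr.
by near: n; exact: nbhs_infty_ger.
Unshelve. all: end_near. Qed.

(** The integrand is - s^2 times the derivative of phi, which vanishes at infinity. *)
Lemma integral_center_normal_pdf : (\int[mu]_x ((x - m) * phi x)%:E = 0)%E.
Proof.
pose f x := - ((x - m) / s ^+ 2) * phi x.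
have fE x : (x - m) * phi x = - s ^+ 2 * f x by rewrite /f; field; exact: s_neq0.
have intf : mu.-integrable setT (EFin \o f).
  have := integrableZl measurableT (- s ^- 2) integrable_center_normal_pdf.
  apply: eq_integrable => // x _.
  by rewrite -EFinM /= /f; congr EFin; ring.
under eq_integral do rewrite fE EFinM.
suff if0 : (\int[mu]_x (f x)%:E = 0)%E by rewrite integralZl// if0 mule0.
apply: (@integral_derivative_vanishing _ phi) => //.
- exact: is_derive_normal_pdf.
- move=> x; apply: cvgM; last exact: continuous_normal_pdf.
  by apply: cvgN; apply: cvgMl; apply: cvgB => //; exact: cvg_cst.
- exact/normal_pdf_cvg0/normr_natB_cvgy.
- exact/normal_pdf_cvg0/normr_oppnatB_cvgy.
Qed.

(** The derivative of (x - m) phi is phi - (x - m)^2 / s^2 phi and integrates to 0, while phi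
    integrates to 1. *)
Lemma integral_sqr_normal_pdf :
  (\int[mu]_x ((x - m) ^+ 2 * phi x)%:E = (s ^+ 2)%:E)%E.
Proof.
pose f x := phi x - (x - m) ^+ 2 / s ^+ 2 * phi x.
have fE x : (x - m) ^+ 2 * phi x = s ^+ 2 * (phi x - f x).
  by rewrite /f; field; exact: s_neq0.
have intp := @integrable_normal_pdf R m s.
have intf : mu.-integrable setT (EFin \o f).
  have := integrableB measurableT intp
    (integrableZl measurableT (s ^- 2) integrable_sqr_normal_pdf).
  apply: eq_integrable => // x _.
  by rewrite -EFinM -EFinB /= /f; congr EFin; ring.
under eq_integral do rewrite fE EFinM EFinB.
suff if0 : (\int[mu]_x (f x)%:E = 0)%E.
  rewrite integralZl//; last exact: integrableB.
  by rewrite integralB// integral_normal_pdf if0 sube0 mule1.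
apply: (@integral_derivative_vanishing _ (fun x => (x - m) * phi x)) => //.
- move=> x; have := is_derive_normal_pdf x => dphi.
  apply: is_derive_eq; rewrite /f /GRing.scale /=.
  by ring.
- move=> x; apply: cvgB; first exact: continuous_normal_pdf.
  apply: cvgM; last exact: continuous_normal_pdf.
  by apply: cvgMl; apply: (@cvgM _ _ _ _ (fun y => y - m) (fun y => y - m));
    (apply: cvgB; [exact: cvg_id|exact: cvg_cst]).
- exact/center_normal_pdf_cvg0/normr_natB_cvgy.
- exact/center_normal_pdf_cvg0/normr_oppnatB_cvgy.
Qed.

End normal_moments.

Section normal_charf.
Context {R : realType}.
Notation mu := (@lebesgue_measure R).
Notation phi := (normal_pdf (0 : R) 1).

Let s1 : (1 : R) != 0 := oner_neq0 R.

Let id_phi_integrable : mu.-integrable setT (fun x => (x * phi x)%:E).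
Proof.
apply: eq_integrable (integrable_center_normal_pdf 0 s1) => // x _.
by rewrite subr0.
Qed.

Lemma continuous_affine (r b : R) : continuous (fun x : R => r * x + b).
Proof.
move=> x; apply: cvgD; last exact: cvg_cst.
by apply: cvgMr; exact: cvg_id.
Qed.

Lemma measurable_cos_affine (r b : R) :
  measurable_fun setT (fun x : R => cos (r * x + b)).
Proof.
apply: continuous_measurable_fun => x.
by apply: continuous_comp; [exact: continuous_affine|exact: continuous_cos].
Qed.

Lemma measurable_sin_affine (r b : R) :
  measurable_fun setT (fun x : R => sin (r * x + b)).
Proof.
apply: continuous_measurable_fun => x.
by apply: continuous_comp; [exact: continuous_affine|exact: continuous_sin].
Qed.

Let dominated_integrable (h g : R -> R) : measurable_fun setT h ->
  (forall x, `|h x| <= 1) -> mu.-integrable setT (EFin \o g) ->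
  mu.-integrable setT (fun x => (h x * g x)%:E).
Proof.
move=> mh h1 ig; apply: (le_integrable measurableT _ _ ig).
  apply/measurable_EFinP/measurable_funM => //.
  by case/integrableP: ig => /measurable_EFinP.
move=> x _; rewrite /= lee_fin normrM ler_piMl//.
Qed.

Lemma normr_sin_le1 (x : R) : `|sin x| <= 1.
Proof. by rewrite ler_norml sin_geN1 sin_le1. Qed.

Lemma normr_cos_le1 (x : R) : `|cos x| <= 1.
Proof. by rewrite ler_norml cos_geN1 cos_le1. Qed.

(** The phase [b] replaces complex exponentials: b = 0 and b = - pi / 2 give the real and imaginary
    parts of the characteristic function at [r]. *)
Let g (b r : R) : R := \int[mu]_x (cos (r * x + b) * phi x).

Let sin_int b r : mu.-integrable setT (fun x => (sin (r * x + b) * (x * phi x))%:E).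
Proof.
apply: dominated_integrable => //; first exact: measurable_sin_affine.
by move=> x; exact: normr_sin_le1.
Qed.

Let cos_int b r : mu.-integrable setT (fun x => (cos (r * x + b) * phi x)%:E).
Proof.
apply: dominated_integrable => //; first exact: measurable_cos_affine.
  by move=> x; exact: normr_cos_le1.
exact: integrable_normal_pdf.
Qed.

Let partial_cos b r x :
  is_derive r (1 : R) (fun r => cos (r * x + b) * phi x)
    (- (sin (r * x + b) * (x * phi x))).
Proof.
apply: is_derive_eq; rewrite /GRing.scale /=; ring.
Qed.

(** Integration by parts: since phi' = - x phi, the derivative of sin (r x + b) phi is r cos (r x +
    b) phi - sin (r x + b) x phi. *)
Let sin_phi_parts b r :
  (\int[mu]_x (sin (r * x + b) * (x * phi x)) = r * g b r)%R.
Proof.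
have sin_cvg0 (u : nat -> R) : phi (u n) @[n --> \oo] --> 0 ->
    sin (r * u n + b) * phi (u n) @[n --> \oo] --> 0.
  move=> u0; apply: norm_cvg0; apply: squeeze_cvgr (cvg_cst 0) u0.
  near=> n; rewrite normr_ge0/= normrM (ger0_norm (normal_pdf_ge0 _ _ _)).
  by rewrite ler_piMl ?normal_pdf_ge0// normr_sin_le1.
pose f x := r * (cos (r * x + b) * phi x) - sin (r * x + b) * (x * phi x).
have intrc : mu.-integrable setT (fun x => (r * (cos (r * x + b) * phi x))%:E).
  exact: (integrableZl measurableT r (cos_int b r)).
have : (\int[mu]_x (f x)%:E = 0)%E.
  apply: (@integral_derivative_vanishing _ (fun x => sin (r * x + b) * phi x)).
  - move=> x; have := is_derive_normal_pdf 0 s1 x => dphi.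
    apply: is_derive_eq; rewrite /f /GRing.scale /= subr0 expr1n divr1; ring.
  - have cphi : continuous phi by exact: continuous_normal_pdf.
    move=> x; apply: cvgB.
      apply: cvgMr; apply: cvgM; last exact: cphi.
      by apply: continuous_comp; [exact: continuous_affine|exact: continuous_cos].
    apply: cvgM; last by apply: cvgM; [exact: cvg_id|exact: cphi].
    by apply: continuous_comp; [exact: continuous_affine|exact: continuous_sin].
  - exact: (integrableB measurableT intrc (sin_int b r)).
  - apply: (sin_cvg0 (fun n => n%:R)).
    exact: (normal_pdf_cvg0 s1 (@normr_natB_cvgy R 0)).
  - apply: (sin_cvg0 (fun n => - n%:R)).
    exact: (normal_pdf_cvg0 s1 (@normr_oppnatB_cvgy R 0)).
move=> /(congr1 fine); rewrite -[LHS]/(\int[mu]_x f x).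
have -> : \int[mu]_x f x = r * g b r - \int[mu]_x (sin (r * x + b) * (x * phi x)).
  rewrite /f RintegralB//; last exact: sin_int.
  by rewrite (RintegralZl r measurableT (cos_int b r)).
by move=> /eqP; rewrite subr_eq0 => /eqP <-.
Unshelve. all: end_near. Qed.

(** Differentiation under the integral sign, with |x phi x| as the dominating function uniformly in
    [r]; [sin_phi_parts] then turns the result into a differential equation for [g b]. *)
Let is_derive_g b r : is_derive r (1 : R) (g b) (- r * g b r).
Proof.
pose f r x := cos (r * x + b) * phi x.
have rI : `]r - 1, r + 1[%classic r by rewrite /= in_itv/= ltrBlDr ltrDl ltr01.
have fint r' : `]r - 1, r + 1[%classic r' -> mu.-integrable setT (EFin \o f r').
  by move=> _; exact: cos_int.
have fder r' (x : R) : `]r - 1, r + 1[%classic r' -> setT x ->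
    derivable (f ^~ x) r' 1.
  by move=> _ _; apply: ex_derive.
have dfE r' (x : R) : partial1of2 f r' x = - (sin (r' * x + b) * (x * phi x)).
  by rewrite partial1of2E; case: (partial_cos b r' x).
have Gint : mu.-integrable setT (EFin \o (fun x => `|x * phi x|)).
  exact: (integrable_abse id_phi_integrable).
have fub r' (x : R) : `]r - 1, r + 1[%classic r' -> setT x ->
    `|partial1of2 f r' x| <= `|x * phi x|.
  by move=> _ _; rewrite dfE normrN normrM ler_piMl// normr_sin_le1.
apply: DeriveDef.
  exact: (derivable_under_integral measurableT rI fint fder _ Gint fub).
rewrite -derive1E (differentiation_under_integral measurableT rI fint fder _ Gint fub)//.
rewrite mulNr -sin_phi_parts -mulN1r -RintegralZl//; last exact: sin_int.
by apply: eq_Rintegral => x _; rewrite dfE mulN1r.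
Qed.

(** By the differential equation g' = - r g, the product of [g b r] and exp (r^2 / 2) is constant in
    [r]; at r = 0 it is cos b. *)
Lemma cos_normal_pdf b r :
  \int[mu]_x (cos (r * x + b) * phi x) = cos b * expR (- r ^+ 2 / 2).
Proof.
pose h r := g b r * expR (r ^+ 2 / 2).
have dh (x : R) : is_derive x (1 : R) h 0.
  have dg := is_derive_g b x.
  by apply: is_derive_eq; rewrite /GRing.scale /=; field.
have h0 : h 0 = cos b.
  rewrite /h expr0n/= mul0r expR0 mulr1 /g.
  under eq_Rintegral do rewrite mul0r add0r.
  rewrite RintegralZl//; last exact: integrable_normal_pdf.
  by rewrite /Rintegral integral_normal_pdf/= mulr1.
rewrite -h0 (is_derive_0_is_cst 0 r dh) /h -mulrA -expRD.
by rewrite (_ : _ + _ = 0) ?expR0 ?mulr1//; field.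
Qed.

End normal_charf.

(** * Gaussian random variables *)

Section law_transfer.
Context d d' (T : measurableType d) (U : measurableType d') (R : realType).
Context (P : probability T R) (Y : {mfun T >-> U}).
Context (nu : {measure set U -> \bar R}).
Hypothesis Ynu : forall A : set U, measurable A -> pushforward P Y A = nu A.

Let integral_distribution_law (f : U -> \bar R) :
  (\int[distribution P Y]_y f y = \int[nu]_y f y)%E.
Proof. by apply: eq_measure_integral => A mA _; exact: Ynu. Qed.

Lemma integrable_law (f : U -> R) : measurable_fun setT f ->
  nu.-integrable setT (EFin \o f) -> P.-integrable setT (EFin \o (f \o Y)).
Proof.
move=> mf /integrableP[_ fnu]; apply/integrableP; split.
  exact/measurable_EFinP/measurableT_comp.
have mnf : measurable_fun setT (fun x => (`|f x|)%:E).
  exact/measurable_EFinP/measurableT_comp.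
have := @ge0_integral_distribution _ _ _ _ _ P Y (fun x => (`|f x|)%:E) mnf.
move=> /(_ (fun=> normr_ge0 _)) /= <-.
by rewrite integral_distribution_law.
Qed.

Lemma Rintegral_law (f : U -> R) : measurable_fun setT f ->
  nu.-integrable setT (EFin \o f) ->
  \int[P]_w f (Y w) = \int[nu]_x f x.
Proof.
move=> mf fnu; have iP := integrable_law mf fnu.
congr fine; rewrite -(@integral_distribution _ _ _ _ _ P Y (EFin \o f))//.
exact/measurable_EFinP.
Qed.

End law_transfer.

Section normal_law_transfer.
Context d (T : measurableType d) (R : realType) (P : probability T R).
Context (Y : {RV P >-> R}) (m s : R).
Hypothesis s_neq0 : s != 0.
Hypothesis Y_law : has_gaussian_law P m s Y.

Let Y_law' (A : set (measurableTypeR R)) : measurable A ->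
  pushforward P Y A = normal_prob m s A.
Proof. by move=> /Y_law; rewrite /gaussian_law (negbTE s_neq0). Qed.

Let mY : measurable_fun [set: T] (Y : T -> measurableTypeR R).
Proof. exact: (measurable_funP Y). Qed.

(** The same map as [Y], with its codomain carrying the measurable structure on which [normal_prob]
    lives. *)
Let Y' : {mfun T >-> measurableTypeR R} :=
  HB.pack (Y : T -> measurableTypeR R) (isMeasurableFun.Build _ _ _ _ _ mY).

Lemma integral_normal_law (f : R -> R) : measurable_fun setT f ->
  (@lebesgue_measure R).-integrable setT
    (fun x => (f x * normal_pdf m s x)%:E) ->
  P.-integrable setT (EFin \o (f \o Y)) /\
  \int[P]_w f (Y w) = \int[@lebesgue_measure R]_x (f x * normal_pdf m s x).
Proof.
move=> mf intf; have [intf' f'E] := integral_normal_prob mf intf.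
split; first exact: (@integrable_law _ _ _ _ _ _ Y' _ Y_law' f).
transitivity (\int[normal_prob m s]_x f x); last by congr fine.
exact: (@Rintegral_law _ _ _ _ _ _ Y' _ Y_law' f).
Qed.

End normal_law_transfer.

Section gaussian_law_theory.
Context d (T : measurableType d) (R : realType) (P : probability T R).
Implicit Type Y : {RV P >-> R}.

Let msq : measurable_fun [set: R] (fun x : R => x ^+ 2).
Proof. exact: measurable_funX. Qed.

Let dirac_moments Y (m : R) : has_gaussian_law P m 0 Y ->
  [/\ P.-integrable setT (EFin \o Y),
      P.-integrable setT (EFin \o (fun w => Y w ^+ 2)),
      \int[P]_w Y w = m &
      \int[P]_w (Y w ^+ 2) = m ^+ 2].
Proof.
rewrite /has_gaussian_law /gaussian_law eqxx => law.
have mid : measurable_fun [set: R] (@id R) by [].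
have dint (f : R -> R) : measurable_fun setT f ->
    (@dirac _ R m R).-integrable setT (EFin \o f).
  move=> mf; apply/integrableP; split; first exact/measurable_EFinP.
  rewrite integral_dirac//; last exact/measurable_EFinP/measurableT_comp.
  by rewrite diracT mul1e ltry.
have dE (f : R -> R) : measurable_fun setT f -> \int[@dirac _ R m R]_x f x = f m.
  move=> mf; rewrite /Rintegral integral_dirac//; last exact/measurable_EFinP.
  by rewrite diracT mul1e.
split.
- exact: (integrable_law law mid (dint _ mid)).
- exact: (integrable_law law msq (dint _ msq)).
- by rewrite (Rintegral_law law mid (dint _ mid)) dE.
- by rewrite (Rintegral_law law msq (dint _ msq)) dE.
Qed.

(** For s = 0 the law is a Dirac mass. Otherwise x and x^2 are expanded around [m], and the centred
    moments of the density are inserted. *)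
Lemma gaussian_law_moments Y (m s : R) : has_gaussian_law P m s Y ->
  [/\ P.-integrable setT (EFin \o Y),
      P.-integrable setT (EFin \o (fun w => Y w ^+ 2)),
      \int[P]_w Y w = m &
      \int[P]_w (Y w ^+ 2) = m ^+ 2 + s ^+ 2].
Proof.
have [->|s0 law] := eqVneq s 0.
  by rewrite expr0n/= addr0; exact: dirac_moments.
have mid : measurable_fun [set: R] (@id R) by [].
have i0 := @integrable_normal_pdf R m s.
have i1 := integrable_center_normal_pdf m s0.
have i2 := integrable_sqr_normal_pdf m s0.
have ia (a : R) := integrableZl measurableT a i0.
have ib (a : R) := integrableZl measurableT a i1.
have idE (x : R) : ((x * normal_pdf m s x)%:E =
    ((x - m) * normal_pdf m s x)%:E + m%:E * (normal_pdf m s x)%:E)%E.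
  by rewrite -EFinM -EFinD; congr EFin; ring.
have sqE (x : R) : ((x ^+ 2 * normal_pdf m s x)%:E =
    (((x - m) ^+ 2 * normal_pdf m s x)%:E +
     ((2 * m)%:E * ((x - m) * normal_pdf m s x)%:E +
      (m ^+ 2)%:E * (normal_pdf m s x)%:E)))%E.
  by rewrite -!EFinM -!EFinD; congr EFin; ring.
have ix : (@lebesgue_measure R).-integrable setT (fun x => (x * normal_pdf m s x)%:E).
  apply: eq_integrable (integrableD measurableT i1 (ia m)) => // x _.
have ibb := integrableD measurableT (ib (2 * m)) (ia (m ^+ 2)).
have ix2 : (@lebesgue_measure R).-integrable setT
    (fun x => (x ^+ 2 * normal_pdf m s x)%:E).
  apply: eq_integrable (integrableD measurableT i2 ibb) => // x _.
have [iY EY] := integral_normal_law s0 law mid ix.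
have [iY2 EY2] := integral_normal_law s0 law msq ix2.
split => //.
- rewrite EY /Rintegral; under eq_integral do rewrite idE.
  rewrite integralD// integral_center_normal_pdf// integralZl//.
  by rewrite integral_normal_pdf mule1 add0e.
- rewrite EY2 /Rintegral; under eq_integral do rewrite sqE.
  rewrite (integralD measurableT i2 ibb) integral_sqr_normal_pdf//.
  rewrite (integralD measurableT (ib (2 * m)) (ia (m ^+ 2))).
  rewrite !integralZl// integral_center_normal_pdf// integral_normal_pdf.
  by rewrite mule0 add0e mule1 -EFinD/= addrC.
Qed.

Lemma cos_normal_law Y (r b : R) : has_gaussian_law P 0 1 Y ->
  \int[P]_w cos (r * Y w + b) = cos b * expR (- r ^+ 2 / 2).
Proof.
move=> law; rewrite -cos_normal_pdf.
have mc := measurable_cos_affine r b.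
have [||_] := @integral_normal_law _ _ _ _ _ 0 1 _ law _ mc => //.
apply: (le_integrable measurableT _ _ (@integrable_normal_pdf R 0 1)).
  by apply/measurable_EFinP/measurable_funM => //; exact: measurable_normal_pdf.
move=> x _; rewrite lee_fin normrM ler_piMl//; exact: normr_cos_le1.
Qed.

(** Joint Gaussianity only provides some parameters [m] and [s]; the first two moments pin them
    down. *)
Lemma gaussian_law_identify Y (m s t : R) : 0 <= s -> 0 <= t ->
  has_gaussian_law P m s Y ->
  \int[P]_w Y w = 0 -> \int[P]_w (Y w ^+ 2) = t ^+ 2 ->
  has_gaussian_law P 0 t Y.
Proof.
move=> s0 t0 law EY EY2; have [_ _ Em E2] := gaussian_law_moments law.
have m0 : m = 0 by rewrite -Em.
move: E2; rewrite EY2 m0 expr0n/= add0r => /eqP.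
by rewrite eqrXn2// => /eqP ->; rewrite -m0.
Qed.

End gaussian_law_theory.

(** * Pairwise independence *)

Section bounded_convergence.
Context d (T : measurableType d) (R : realType) (P : probability T R).

Lemma bounded_measurable_integrable (f : T -> R) (M : R) :
  measurable_fun setT f -> (forall w, `|f w| <= M) ->
  P.-integrable setT (EFin \o f).
Proof.
move=> mf fM.
have iM : P.-integrable setT (EFin \o cst M).
  exact: finite_measure_integrable_cst.
apply: (le_integrable measurableT _ _ iM).
  exact/measurable_EFinP.
by move=> w _; rewrite /= lee_fin (le_trans (fM w))// ler_norm.
Qed.

Lemma bounded_convergence (f_ : nat -> T -> R) (f : T -> R) :
  (forall n, measurable_fun setT (f_ n)) -> (forall n w, `|f_ n w| <= 1) ->
  (forall w, `|f w| <= 1) ->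
  (forall w, f_ n w @[n --> \oo] --> f w) ->
  \int[P]_w f_ n w @[n --> \oo] --> \int[P]_w f w.
Proof.
move=> mf_ f_1 f1 f_f.
have mf : measurable_fun setT f by exact: (measurable_fun_cvg mf_ (fun w _ => f_f w)).
have intf := bounded_measurable_integrable mf f1.
apply: fine_cvg; rewrite fineK; last exact: integrable_fin_num.
apply: (@dominated_cvg _ _ _ P _ measurableT (fun n w => (f_ n w)%:E) _
  (cst 1%E)) => //.
- by move=> n; exact/measurable_EFinP.
- by move=> w _; apply: cvg_EFin; [exact: nearW|exact: f_f].
- by rewrite -/(EFin \o cst 1); exact: finite_measure_integrable_cst.
- by move=> n w _; rewrite lee_fin.
Qed.

End bounded_convergence.

(** * Polynomial approximation of the sign function *)

Section sign_iteration.
Context {R : realType}.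

(* The iterates of this odd cubic converge to the sign function on [-1, 1]:
   1 - p y = (1 - y)^2 (2 + y) / 2. *)
Definition sign_step (y : R) : R := y * (3 - y ^+ 2) / 2.

Lemma iter_sign_stepN (n : nat) (y : R) :
  iter n sign_step (- y) = - iter n sign_step y.
Proof.
elim: n => //= n ->; rewrite /sign_step sqrrN; ring.
Qed.

Lemma iter_sign_step_itv (n : nat) (y : R) : 0 <= y <= 1 ->
  y <= iter n sign_step y <= 1.
Proof.
move=> /andP[y0 y1]; elim: n => /= [|n /andP[]]; first by rewrite lexx.
set z := iter _ _ _ => yz z1; have z0 : 0 <= z by exact: le_trans yz.
rewrite /sign_step; apply/andP; split.
  have : 0 <= z * ((1 - z) * (1 + z)).
    by rewrite mulr_ge0// mulr_ge0; lra.
  by rewrite [_ * _](_ : _ = z - z * z ^+ 2); [lra|ring].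
have : 0 <= (1 - z) ^+ 2 * (2 + z) by rewrite mulr_ge0 ?sqr_ge0//; lra.
by rewrite [_ * _](_ : _ = 2 - z * (3 - z ^+ 2)); [lra|ring].
Qed.

Lemma iter_sign_step_le1 (n : nat) (y : R) : `|y| <= 1 ->
  `|iter n sign_step y| <= 1.
Proof.
wlog y0 : y / 0 <= y => [hw y1|].
  have [/hw|/ltW y0] := leP 0 y; first exact.
  by rewrite -(opprK y) iter_sign_stepN normrN hw ?oppr_ge0 ?normrN.
rewrite ger0_norm// => y1.
have /andP[h1 h2] : y <= iter n sign_step y <= 1.
  by apply: iter_sign_step_itv; rewrite y0.
by rewrite ger0_norm// (le_trans y0).
Qed.

(** One step multiplies the gap 1 - z by 1 - z / 2 - z^2 / 2, which is at most 1 - y / 2 because the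
    iterates never fall below [y]. *)
Lemma iter_sign_step_rate (n : nat) (y : R) : 0 <= y <= 1 ->
  1 - iter n sign_step y <= (1 - y / 2) ^+ n.
Proof.
move=> y01; have /andP[y0 y1] := y01.
elim: n => [|n IH]; first by rewrite expr0 /= gerBl.
rewrite exprS /=; apply: (@le_trans _ _ ((1 - y / 2) * (1 - iter n sign_step y))).
  have /andP[] := iter_sign_step_itv n y01.
  set z := iter _ _ _ => yz z1; rewrite /sign_step.
  have -> : 1 - z * (3 - z ^+ 2) / 2 = (1 - z / 2 - z ^+ 2 / 2) * (1 - z) by field.
  apply: ler_wpM2r; first by rewrite subr_ge0.
  by have := sqr_ge0 z; lra.
by apply: ler_wpM2l => //; lra.
Qed.

Lemma cvg_iter_sign_step (y : R) : `|y| <= 1 ->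
  iter n sign_step y @[n --> \oo] --> Num.sg y.
Proof.
have pos (z : R) : 0 < z -> z <= 1 -> iter n sign_step z @[n --> \oo] --> (1 : R).
  move=> z0 z1; have z01 : 0 <= z <= 1 by rewrite ltW.
  apply: (@squeeze_cvgr _ _ _ _ (fun n => 1 - (1 - z / 2) ^+ n) (fun=> 1)).
  - near=> n; have /andP[_ ->] := iter_sign_step_itv n z01.
    by rewrite andbT; have := iter_sign_step_rate n z01; lra.
  - rewrite -[X in _ --> X](subr0 1); apply: cvgB; first exact: cvg_cst.
    by apply: cvg_expr; rewrite ger0_norm; lra.
  - exact: cvg_cst.
have [y0|y0|->] := ltgtP y 0.
- rewrite ltr0_norm// ltr0_sg// => y1.
  rewrite -(opprK y); under eq_fun do rewrite iter_sign_stepN.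
  by apply: cvgN; apply: pos => //; rewrite oppr_gt0.
- by rewrite gtr0_norm// gtr0_sg// => y1; exact: pos.
- move=> _; rewrite sgr0; apply: cvg_near_cst; apply: nearW => n.
  by elim: n => //= n ->; rewrite /sign_step mul0r mul0r.
Unshelve. all: end_near. Qed.

End sign_iteration.

(** * From the joint characteristic function to indicators of half-lines *)

Section pairwise_independence.
Context d (T : measurableType d) (R : realType) (P : probability T R).

(** Phases make sines and constants special cases of the cosine constructor, and the product-to-sum
    formula gives closure under products. *)
Inductive trig_poly : (R -> R) -> Prop :=
| trig_poly_cos c a b : trig_poly (fun x => c * cos (a * x + b))
| trig_polyD f g : trig_poly f -> trig_poly g ->
    trig_poly (fun x => f x + g x).

Lemma trig_poly_ext (f g : R -> R) : f =1 g -> trig_poly f -> trig_poly g.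
Proof. by move=> /funext ->. Qed.

Lemma trig_polyM (f g : R -> R) :
  trig_poly f -> trig_poly g -> trig_poly (fun x => f x * g x).
Proof.
move=> tf tg; elim: tf => [c a b|f1 f2 _ IH1 _ IH2]; last first.
  by apply: trig_poly_ext (trig_polyD IH1 IH2) => x; rewrite mulrDl.
elim: tg => [c' a' b'|g1 g2 _ IH1 _ IH2]; last first.
  by apply: trig_poly_ext (trig_polyD IH1 IH2) => x; rewrite mulrDr.
apply: trig_poly_ext (trig_polyD
  (trig_poly_cos (c * c' / 2) (a + a') (b + b'))
  (trig_poly_cos (c * c' / 2) (a - a') (b - b'))) => x.
have -> : (a + a') * x + (b + b') = (a * x + b) + (a' * x + b') by ring.
have -> : (a - a') * x + (b - b') = (a * x + b) - (a' * x + b') by ring.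
by rewrite cosD cosB; field.
Qed.

Lemma trig_poly_cst (c : R) : trig_poly (fun=> c).
Proof.
apply: trig_poly_ext (trig_poly_cos c 0 0) => x.
by rewrite mul0r addr0 cos0 mulr1.
Qed.

Lemma trig_poly_sin (a b : R) : trig_poly (fun x => sin (a * x + b)).
Proof.
apply: trig_poly_ext (trig_poly_cos 1 a (b - pi / 2)) => x.
by rewrite mul1r addrA cosBpihalf.
Qed.

Lemma measurable_trig_poly (f : R -> R) : trig_poly f -> measurable_fun setT f.
Proof.
elim=> [c a b|g h _ mg _ mh]; last exact: measurable_funD.
by apply: measurable_funM => //; exact: measurable_cos_affine.
Qed.

Lemma trig_poly_bounded (f : R -> R) : trig_poly f ->
  exists M : R, forall x, `|f x| <= M.
Proof.
elim=> [c a b|g h _ [M gM] _ [N hN]].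
  exists `|c| => x; rewrite normrM ler_piMr//; exact: normr_cos_le1.
by exists (M + N) => x; rewrite (le_trans (ler_normD _ _))// lerD.
Qed.

Variables W1 W2 : {RV P >-> R}.

Definition uncorrelated (f g : R -> R) : Prop :=
  \int[P]_w (f (W1 w) * g (W2 w)) = \int[P]_w f (W1 w) * \int[P]_w g (W2 w).

(** All three expectations pass to the limit by bounded convergence. This carries the product rule
    from trigonometric polynomials to step functions. *)
Lemma uncorrelated_cvg (f_ g_ : nat -> R -> R) (f g : R -> R) :
  (forall n, measurable_fun setT (f_ n)) -> (forall n, measurable_fun setT (g_ n)) ->
  (forall n x, `|f_ n x| <= 1) -> (forall n x, `|g_ n x| <= 1) ->
  (forall x, `|f x| <= 1) -> (forall x, `|g x| <= 1) ->
  (forall x, f_ n x @[n --> \oo] --> f x) ->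
  (forall x, g_ n x @[n --> \oo] --> g x) ->
  (forall n, uncorrelated (f_ n) (g_ n)) -> uncorrelated f g.
Proof.
move=> mf mg f_1 g_1 f1 g1 f_f g_g fg; rewrite /uncorrelated.
have cf : \int[P]_w f_ n (W1 w) @[n --> \oo] --> \int[P]_w f (W1 w).
  apply: bounded_convergence => //.
  by move=> n; apply: measurableT_comp.
have cg : \int[P]_w g_ n (W2 w) @[n --> \oo] --> \int[P]_w g (W2 w).
  apply: bounded_convergence => //.
  by move=> n; apply: measurableT_comp.
have cfg : \int[P]_w (f_ n (W1 w) * g_ n (W2 w)) @[n --> \oo] -->
    \int[P]_w (f (W1 w) * g (W2 w)).
  apply: bounded_convergence => //.
  - by move=> n; apply: measurable_funM; exact: measurableT_comp.
  - by move=> n w; rewrite normrM mulr_ile1.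
  - by move=> w; rewrite normrM mulr_ile1.
  - by move=> w; apply: cvgM.
rewrite -(cvg_lim _ cfg)//; apply: cvg_lim => //.
under eq_fun do rewrite fg.
exact: cvgM.
Qed.

Hypothesis joint_charf : forall a1 a2 b : R,
  \int[P]_w cos (a1 * W1 w + a2 * W2 w + b) =
  cos b * expR (- (a1 ^+ 2 + a2 ^+ 2) / 2).

Let Pint (f g : R -> R) : trig_poly f -> trig_poly g ->
  P.-integrable setT (fun w => (f (W1 w) * g (W2 w))%:E).
Proof.
move=> tf tg; have [M fM] := trig_poly_bounded tf.
have [N gN] := trig_poly_bounded tg.
apply: (@bounded_measurable_integrable _ _ _ P _ (M * N)).
  by apply: measurable_funM; apply: measurableT_comp => //; exact: measurable_trig_poly.
by move=> w; rewrite normrM ler_pM.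
Qed.

Let Pint1 (f : R -> R) (W : {RV P >-> R}) : trig_poly f ->
  P.-integrable setT (fun w => (f (W w))%:E).
Proof.
move=> tf; have [M fM] := trig_poly_bounded tf.
apply: (@bounded_measurable_integrable _ _ _ P _ M) => //.
by apply: measurableT_comp => //; exact: measurable_trig_poly.
Qed.

(** Bilinearity reduces to two cosines, whose product is a sum of two cosines with frequencies (a,
    a') and (a, - a'). The joint characteristic function takes the same Gaussian factor at both, so
    the phases recombine to cos b cos b' and the factor splits. *)
Lemma uncorrelated_trig_poly (f g : R -> R) :
  trig_poly f -> trig_poly g -> uncorrelated f g.
Proof.
move=> tf tg; elim: tf => [c a b|f1 f2 t1 IH1 t2 IH2]; last first.
  rewrite /uncorrelated (RintegralD _ (Pint1 W1 t1) (Pint1 W1 t2))//.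
  rewrite mulrDl -IH1 -IH2 -(RintegralD _ (Pint t1 tg) (Pint t2 tg))//.
  by apply: eq_Rintegral => w _; rewrite mulrDl.
have tc : trig_poly (fun x => c * cos (a * x + b)) by exact: trig_poly_cos.
elim: tg => [c' a' b'|g1 g2 t1 IH1 t2 IH2]; last first.
  rewrite /uncorrelated (RintegralD _ (Pint1 W2 t1) (Pint1 W2 t2))//.
  rewrite mulrDr -IH1 -IH2 -(RintegralD _ (Pint tc t1) (Pint tc t2))//.
  by apply: eq_Rintegral => w _; rewrite mulrDr.
have mW (a1 a2 b1 : R) :
    P.-integrable setT (fun w => (cos (a1 * W1 w + a2 * W2 w + b1))%:E).
  apply: (@bounded_measurable_integrable _ _ _ P _ 1) => [|w];
    last exact: normr_cos_le1.
  apply: measurableT_comp.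
    by apply: continuous_measurable_fun; exact: continuous_cos.
  by apply: measurable_funD => //; apply: measurable_funD; exact: measurable_funM.
have E1 : \int[P]_w (c * cos (a * W1 w + b)) = c * (cos b * expR (- a ^+ 2 / 2)).
  have := joint_charf a 0 b; rewrite expr0n/= addr0 => <-.
  rewrite -(RintegralZl _ measurableT (mW _ _ _)).
  by apply: eq_Rintegral => w _; rewrite mul0r addr0.
have E2 : \int[P]_w (c' * cos (a' * W2 w + b')) = c' * (cos b' * expR (- a' ^+ 2 / 2)).
  have := joint_charf 0 a' b'; rewrite expr0n/= add0r => <-.
  rewrite -(RintegralZl _ measurableT (mW _ _ _)).
  by apply: eq_Rintegral => w _; rewrite mul0r add0r.
rewrite /uncorrelated E1 E2.
transitivity (\int[P]_w (c * c' / 2 *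
    (cos (a * W1 w + a' * W2 w + (b + b')) +
     cos (a * W1 w + (- a') * W2 w + (b - b'))))).
  apply: eq_Rintegral => w _.
  have -> : a * W1 w + a' * W2 w + (b + b') =
    (a * W1 w + b) + (a' * W2 w + b') by ring.
  have -> : a * W1 w + (- a') * W2 w + (b - b') =
    (a * W1 w + b) - (a' * W2 w + b') by ring.
  by rewrite (cosD (a * W1 w + b)) cosB; field.
rewrite RintegralZl//; last exact: (integrableD measurableT (mW _ _ _) (mW _ _ _)).
rewrite (RintegralD _ (mW _ _ _) (mW _ _ _))// !joint_charf cosD cosB sqrrN.
have -> : - (a ^+ 2 + a' ^+ 2) / 2 = - a ^+ 2 / 2 + - a' ^+ 2 / 2 by field.
by rewrite expRD; field.
Qed.

(* The indicator of ]t, +oo[, with value 1/2 at t. *)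
Definition half_step (t x : R) : R := (1 + Num.sg (x - t)) / 2.

Lemma half_step_ge0 t x : 0 <= half_step t x.
Proof. by rewrite /half_step; case: sgrP => _; lra. Qed.

Lemma half_step_le1 t x : half_step t x <= 1.
Proof. by rewrite /half_step; case: sgrP => _; lra. Qed.

Lemma normr_half_le1 (y : R) : `|y| <= 1 -> `|(1 + y) / 2| <= 1.
Proof. by rewrite !ler_norml => /andP[? ?]; lra. Qed.

Lemma normr_sg_le1 (y : R) : `|Num.sg y| <= 1.
Proof. by rewrite normr_sg; case: (_ == _). Qed.

(* As n grows this tends to the half-step of the sine wave of period
   2 pi L vanishing at t, and then, as L grows, to [half_step t]. *)
Let fn (t L : R) n x := (1 + iter n sign_step (sin (L^-1 * x + (- t / L)))) / 2.

Let fn_trig t L n : trig_poly (fn t L n).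
Proof.
(* Each iterate is a polynomial in a sine, hence again a trigonometric polynomial. *)
have it : trig_poly (fun x => iter n sign_step (sin (L^-1 * x + (- t / L)))).
  elim: n => [|n IH]; first exact: trig_poly_sin.
  have := trig_polyM (trig_polyM IH (trig_polyD (trig_poly_cst 3)
    (trig_polyM (trig_poly_cst (-1)) (trig_polyM IH IH)))) (trig_poly_cst (2^-1)).
  by apply: trig_poly_ext => x; rewrite /= /sign_step; field.
have := trig_polyM (trig_polyD (trig_poly_cst 1) it) (trig_poly_cst (2^-1)).
by apply: trig_poly_ext => x.
Qed.

Let fn1 t L n x : `|fn t L n x| <= 1.
Proof. by apply/normr_half_le1/iter_sign_step_le1/normr_sin_le1. Qed.

Let fnL (t L x : R) : R := (1 + Num.sg (sin (L^-1 * x + (- t / L)))) / 2.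

Let fn_cvg t L x : fn t L n x @[n --> \oo] --> fnL t L x.
Proof.
apply: cvgMl; apply: cvgD; first exact: cvg_cst.
exact/cvg_iter_sign_step/normr_sin_le1.
Qed.

Let mfn t L n : measurable_fun setT (fn t L n).
Proof. exact: measurable_trig_poly. Qed.

Let fnL_uncorrelated t L : uncorrelated (fnL t L) (fnL t L).
Proof.
apply: (@uncorrelated_cvg (fn t L) (fn t L)) => // [x|x|n].
- exact/normr_half_le1/normr_sg_le1.
- exact/normr_half_le1/normr_sg_le1.
- exact: uncorrelated_trig_poly.
Qed.

(** Once |z| / (n + 1) < pi, the sine has the sign of [z], so the sequence is eventually
    constant. *)
Let sg_sin_cvg (z : R) :
  Num.sg (sin (n.+1%:R^-1 * z)) @[n --> \oo] --> Num.sg z.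
Proof.
have pos (y : R) : 0 < y -> \forall n \near \oo, 0 < sin (n.+1%:R^-1 * y).
  move=> y0; near=> n.
  apply: sin_gt0_pi; rewrite mulr_gt0//=.
  rewrite mulrC ltr_pdivrMr// -ltr_pdivrMl ?pi_gt0//.
  near: n; exists (Num.truncn (pi^-1 * y)) => // n /= ny.
  by rewrite (lt_le_trans (truncnS_gt _))// ler_nat ltnS.
apply: cvg_near_cst; have [z0|z0|->] := ltgtP z 0.
- near=> n; rewrite (ltr0_sg z0) ltr0_sg// -oppr_gt0 -sinN -mulrN.
  by near: n; apply: pos; rewrite oppr_gt0.
- near=> n; rewrite (gtr0_sg z0) gtr0_sg//.
  by near: n; exact: pos.
- by near=> n; rewrite mulr0 sin0.
Unshelve. all: end_near. Qed.

Let fnL_cvg t x : fnL t n.+1%:R x @[n --> \oo] --> half_step t x.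
Proof.
have fnLE n : fnL t n.+1%:R x = (1 + Num.sg (sin (n.+1%:R^-1 * (x - t)))) / 2.
  by rewrite /fnL mulrBr mulNr (mulrC t).
under eq_fun do rewrite fnLE.
by apply: cvgMl; apply: cvgD; [exact: cvg_cst|exact: sg_sin_cvg].
Qed.

Let mfnL t L : measurable_fun setT (fnL t L).
Proof. by apply: (measurable_fun_cvg (mfn t L)) => x _; exact: fn_cvg. Qed.

Lemma measurable_half_step t : measurable_fun setT (half_step t).
Proof.
by apply: (measurable_fun_cvg (fun n => mfnL t n.+1%:R)) => x _; exact: fnL_cvg.
Qed.

Lemma half_step_uncorrelated t : uncorrelated (half_step t) (half_step t).
Proof.
by apply: (@uncorrelated_cvg (fun n => fnL t n.+1%:R) (fun n => fnL t n.+1%:R)) => // *;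
  exact/normr_half_le1/normr_sg_le1.
Qed.

End pairwise_independence.

(** * Second moment method *)

Section finite_sums.
Context d (T : measurableType d) (R : realType) (P : probability T R).

Lemma Rintegral_sum (I : Type) (r : seq I) (Q : pred I) (f : I -> T -> R) :
  (forall i, P.-integrable setT (EFin \o f i)) ->
  P.-integrable setT (EFin \o (fun w => \sum_(i <- r | Q i) f i w)) /\
  \int[P]_w (\sum_(i <- r | Q i) f i w) = \sum_(i <- r | Q i) \int[P]_w f i w.
Proof.
move=> intf; elim: r => [|i r [IHi IHe]].
  under eq_Rintegral do rewrite big_nil.
  have -> : EFin \o (fun w => \sum_(i <- [::] | Q i) f i w) = cst 0%E :> (T -> \bar R).
    by apply/funext => w /=; rewrite big_nil.
  split; first exact: integrable0.
  by rewrite big_nil /Rintegral integral0.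
rewrite big_cons; case: ifPn => Qi; last first.
  have -> : (fun w => \sum_(j <- i :: r | Q j) f j w) =
      (fun w => \sum_(j <- r | Q j) f j w).
    by apply/funext => w; rewrite big_cons (negbTE Qi).
  by [].
have -> : (fun w => \sum_(j <- i :: r | Q j) f j w) =
    (fun w => f i w + \sum_(j <- r | Q j) f j w).
  by apply/funext => w; rewrite big_cons Qi.
split; first exact: (integrableD measurableT (intf i) IHi).
by rewrite (RintegralD _ (intf i) IHi)// IHe.
Qed.

(** Integrate the pointwise bound c^2 1_B <= f^2. *)
Lemma markov_sqr (f : T -> R) (c : R) : 0 < c ->
  P.-integrable setT (EFin \o (fun w => f w ^+ 2)) ->
  forall B : set T, measurable B -> (forall w, B w -> c <= `|f w|) ->
  fine (P B) <= c ^- 2 * \int[P]_w (f w ^+ 2).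
Proof.
move=> c0 intf B mB Bc.
rewrite mulrC ler_pdivlMr ?exprn_gt0// mulrC.
rewrite -[fine _]mulr1 -[X in _ * (_ * X)]/(fine 1%E).
have -> : c ^+ 2 * (fine (P B) * fine 1%E) = \int[P]_w (c ^+ 2 * \1_B w).
  rewrite RintegralZl//; last first.
    exact: integrable_indic.
  by rewrite /Rintegral integral_indic// setIT /= mulr1.
apply: le_Rintegral => //.
  have iB : P.-integrable setT (EFin \o (\1_B : T -> R)) by exact: integrable_indic.
  exact: (integrableZl measurableT (c ^+ 2) iB).
move=> w _; rewrite indicE; case: (boolP (w \in B)) => [/set_mem wB|_].
  by rewrite mulr1 -(real_normK (num_real (f w))) lerXn2r ?nnegrE ?Bc// ltW.
by rewrite mulr0 sqr_ge0.
Qed.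

End finite_sums.

Lemma card_setIn_sum (R : nzSemiRingType) (I : finType) (A : {set I}) (b : pred I) :
  #|[set i in A | b i]%SET|%:R = \sum_(i in A) (b i)%:R :> R.
Proof.
rewrite -sum1_card natr_sum big_mkcond [RHS]big_mkcond /=.
by apply: eq_bigr => i _; rewrite inE; case: (i \in A); case: (b i).
Qed.

Lemma measurable_card_ge d (T : measurableType d) (R : realType) (I : finType)
    (A : {set I}) (b : I -> T -> bool) (k : nat) :
  (forall i, measurable [set w | b i w]) ->
  measurable [set w | (k <= #|[set i in A | b i w]%SET|)%N].
Proof.
move=> mb.
(* The count is a finite sum of indicators, hence measurable, and the event is the preimage of a
   half-line. *)
pose N w : R := \sum_(i <- enum I) (if i \in A then \1_[set w | b i w] w else 0).
have NE w : #|[set i in A | b i w]%SET|%:R = N w.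
  rewrite card_setIn_sum big_mkcond /N big_enum /=; apply: eq_bigr => i _.
  case: ifP => // _; rewrite indicE; congr (_%:R); congr nat_of_bool.
  by apply/idP/idP => [?|/set_mem//]; exact: mem_set.
have mN : measurable_fun setT N.
  apply: measurable_sum => i; case: (i \in A) => //.
  exact: measurable_indic.
have -> : [set w | (k <= #|[set i in A | b i w]%SET|)%N] = N @^-1` `[k%:R, +oo[.
  by apply/seteqP; split => w /=; rewrite in_itv/= andbT -NE ler_nat.
by rewrite -[X in measurable X]setTI; apply: mN.
Qed.

Section rv_events.
Context d (T : measurableType d) (R : realType) (Y : {mfun T >-> R}) (t : R).

Let measurable_rv_itv (i : interval R) : measurable (Y @^-1` [set` i]).
Proof.
rewrite -[X in measurable X]setTI.
exact: (measurable_funP Y measurableT _ (measurable_itv i)).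
Qed.

Lemma measurable_rv_ge : measurable [set w | t <= Y w].
Proof.
have := measurable_rv_itv `[t, +oo[; congr measurable.
by apply/seteqP; split => w /=; rewrite in_itv/= andbT.
Qed.

Lemma measurable_rv_gt : measurable [set w | t < Y w].
Proof.
have := measurable_rv_itv `]t, +oo[; congr measurable.
by apply/seteqP; split => w /=; rewrite in_itv/= andbT.
Qed.

Lemma measurable_rv_le : measurable [set w | Y w <= t].
Proof.
by have := measurable_rv_itv `]-oo, t]; congr measurable.
Qed.

End rv_events.

Section second_moment.
Context d (T : measurableType d) (R : realType) (P : probability T R).
Context (I : finType) (A : {set I}) (Z : I -> {RV P >-> R}) (t p : R).
Hypothesis EZ : forall i, i \in A -> \int[P]_w half_step t (Z i w) = p.
Hypothesis cZ : forall i j, i \in A -> j \in A -> i != j ->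
  uncorrelated (Z i) (Z j) (half_step t) (half_step t).

Let h i w := half_step t (Z i w).

Let mh i : measurable_fun setT (h i).
Proof. by apply: measurableT_comp => //; exact: measurable_half_step. Qed.

Let hn1 i w : `|h i w| <= 1.
Proof. by rewrite ger0_norm ?half_step_ge0 ?half_step_le1. Qed.

Let ih i : P.-integrable setT (EFin \o h i).
Proof. exact: bounded_measurable_integrable (mh i) (hn1 i). Qed.

Let ihh i j : P.-integrable setT (EFin \o (fun w => h i w * h j w)).
Proof.
apply: (@bounded_measurable_integrable _ _ _ P _ 1).
  exact: measurable_funM.
by move=> w; rewrite normrM mulr_ile1.
Qed.

Let g i w := h i w - p.

Let igg i j : P.-integrable setT (EFin \o (fun w => g i w * g j w)).
Proof.
have mg l : measurable_fun setT (g l) by exact: measurable_funB.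
have gb l w : `|g l w| <= 1 + `|p|.
  by rewrite (le_trans (ler_normB _ _))// lerD.
apply: (@bounded_measurable_integrable _ _ _ P _ ((1 + `|p|) * (1 + `|p|))).
  exact: measurable_funM.
by move=> w; rewrite normrM ler_pM.
Qed.

Let Egg i j : i \in A -> j \in A ->
  \int[P]_w (g i w * g j w) = \int[P]_w (h i w * h j w) - p ^+ 2.
Proof.
move=> iA jA.
have gE w : g i w * g j w = (h i w * h j w - p * h i w) - (p * h j w - p ^+ 2).
  by rewrite /g; ring.
under eq_Rintegral do rewrite gE.
have icst : P.-integrable setT (EFin \o cst (p ^+ 2)).
  exact: finite_measure_integrable_cst.
have ip l : P.-integrable setT (EFin \o (fun w => p * h l w)).
  exact: (integrableZl measurableT p (ih l)).
rewrite (RintegralB _ (integrableB measurableT (ihh i j) (ip i))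
  (integrableB measurableT (ip j) icst))//.
rewrite (RintegralB _ (ihh i j) (ip i))// (RintegralB _ (ip j) icst)//.
rewrite !(RintegralZl _ measurableT (ih _)) !EZ// Rintegral_cst//.
have -> : fine (P [set: T]) = 1 by rewrite probability_setT.
ring.
Qed.

(** Off-diagonal terms vanish since the half-steps are uncorrelated. Each diagonal term is E h^2 -
    p^2 <= E h = p, because 0 <= h <= 1. *)
Let E_sqr_le :
  P.-integrable setT (EFin \o (fun w => (\sum_(i in A) g i w) ^+ 2)) /\
  \int[P]_w ((\sum_(i in A) g i w) ^+ 2) <= #|A|%:R * p.
Proof.
have sqE w : (\sum_(i in A) g i w) ^+ 2 = \sum_(i in A) \sum_(j in A) g i w * g j w.
  by rewrite expr2 big_distrlr.
have -> : (fun w => (\sum_(i in A) g i w) ^+ 2) =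
    (fun w => \sum_(i in A) \sum_(j in A) g i w * g j w) by exact/funext.
have int1 i := Rintegral_sum (index_enum I) (fun j => j \in A) (igg i).
have [iS ->] := Rintegral_sum (index_enum I) (fun i => i \in A) (fun i => (int1 i).1).
split; first exact: iS.
rewrite mulr_natl -sumr_const; apply: ler_sum => i iA.
rewrite (int1 i).2 (bigD1 i)//= big1 ?addr0 => [|j /andP[jA ji]]; last first.
  rewrite Egg// [X in X - _]cZ//; last by rewrite eq_sym.
  by rewrite !EZ// expr2 subrr.
rewrite Egg//; apply: (@le_trans _ _ (\int[P]_w (h i w * h i w))).
  by rewrite gerBl sqr_ge0.
rewrite -(EZ iA); apply: (le_Rintegral _ (ihh i i) (ih i)) => // w _.
by rewrite ler_piMr ?half_step_ge0 ?half_step_le1.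
Qed.

(** Chebyshev's inequality: [half_step t] is at most the indicator of [t, +oo[, so fewer than k <=
    mp / 2 exceedances push the sum of half-steps at least mp / 2 below its mean mp. The variance
    bound mp over (mp / 2)^2 is 4 / mp. *)
Lemma few_exceedances_le (k : nat) : 2 * k%:R <= #|A|%:R * p -> 0 < #|A|%:R * p ->
  fine (P (~` [set w | (k <= #|[set i in A | (t <= Z i w)%R]%SET|)%N])) <=
  4 / (#|A|%:R * p).
Proof.
set mp := #|A|%:R * p => kmp mp0.
have mB : measurable (~` [set w | (k <= #|[set i in A | (t <= Z i w)%R]%SET|)%N]).
  apply: measurableC; apply: (@measurable_card_ge _ _ R) => i.
  exact: measurable_rv_ge.
have [iS ES] := E_sqr_le.
apply: (@le_trans _ _ ((mp / 2) ^- 2 * \int[P]_w ((\sum_(i in A) g i w) ^+ 2))).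
  apply: (markov_sqr _ iS mB); first by rewrite divr_gt0.
  move=> w /negP; rewrite -ltnNge -(ltr_nat R) card_setIn_sum => Nk.
  have hle : \sum_(i in A) h i w <= \sum_(i in A) (t <= Z i w)%R%:R.
    apply: ler_sum => i _; case: (leP t (Z i w)) => ht; first exact: half_step_le1.
    by rewrite /h /half_step ltr0_sg ?subr_lt0// subrr mul0r.
  have -> : \sum_(i in A) g i w = \sum_(i in A) h i w - mp.
    by rewrite sumrB sumr_const /mp mulr_natl.
  by rewrite ler0_norm; lra.
apply: (@le_trans _ _ ((mp / 2) ^- 2 * mp)).
  by apply: ler_wpM2l; rewrite ?invr_ge0 ?sqr_ge0.
by rewrite le_eqVlt; apply/orP; left; apply/eqP; field; rewrite gt_eqF.
Qed.

End second_moment.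

(** * Tails of the standard normal distribution *)

Section Phi_theory.
Context {R : realType}.
Notation mu := (@lebesgue_measure R).
Notation phi := (normal_pdf (0 : R) 1).
Notation N := (normal_prob (0 : R) 1).
Implicit Types x y e p : R.

Let s1 : (1 : R) != 0 := oner_neq0 R.

Let Nfin (A : set (measurableTypeR R)) : measurable A -> N A \is a fin_num.
Proof. by move=> mA; exact: fin_num_measure. Qed.

Lemma PhiB x y : x <= y -> (Phi y - Phi x)%:E = N `]x, y].
Proof.
move=> xy; rewrite /Phi EFinB !fineK ?Nfin//.
have -> : [set` `]-oo, y]] = [set` `]-oo, x]] `|` [set` `]x, y]] :> set R.
  by rewrite -itv_bndbnd_setU.
rewrite measureU//; first by rewrite addeAC subee ?Nfin// add0e.
rewrite -subset0 => z /=; rewrite !in_itv/= => -[zx /andP[]].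
by rewrite ltNge zx.
Qed.

Lemma Phi_lipschitz x y : x <= y -> 0 <= Phi y - Phi x <= normal_peak 1 * (y - x).
Proof.
move=> xy; rewrite -!lee_fin PhiB// measure_ge0/=.
apply: (@le_trans _ _ (\int[mu]_(z in `]x, y]) (normal_peak 1)%:E)%E).
  apply: ge0_le_integral => //.
  - by move=> z _; rewrite lee_fin normal_pdf_ge0.
  - by apply/measurable_EFinP/measurable_funTS; exact: measurable_normal_pdf.
  - by move=> z _; rewrite lee_fin; exact: normal_pdf_ub.
rewrite integral_cst//= lebesgue_measure_itv/= lte_fin.
case: ltP => _; first by rewrite -EFinD -EFinM.
by rewrite mule0 lee_fin mulr_ge0 ?normal_peak_ge0 ?subr_ge0.
Qed.

Lemma Phi_nondecreasing x y : x <= y -> Phi x <= Phi y.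
Proof. by move=> /Phi_lipschitz /andP[]; rewrite subr_ge0. Qed.

Lemma normr_PhiB_le x y : `|Phi x - Phi y| <= normal_peak 1 * `|x - y|.
Proof.
wlog xy : x y / x <= y => [hw|].
  have [/hw//|/ltW/hw] := leP x y; by rewrite distrC (distrC x).
have /andP[h0 h1] := Phi_lipschitz xy.
by rewrite distrC (distrC x) !ger0_norm// subr_ge0.
Qed.

Lemma continuous_Phi : continuous (@Phi R).
Proof.
move=> x; apply/cvgrPdist_le => e e0.
have p0 : 0 < normal_peak (1 : R) by exact: normal_peak_gt0.
near=> y; apply: le_trans (normr_PhiB_le x y) _.
rewrite mulrC -ler_pdivlMr//; near: y.
by apply: cvgr_dist_le => //; exact: divr_gt0.
Unshelve. all: end_near. Qed.

Lemma Phi_tail x : (1 - Phi x)%:E = (\int[mu]_(y in `[x, +oo[) (phi y)%:E)%E.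
Proof.
rewrite -integral_itv_obnd_cbnd; last first.
  by apply/measurable_EFinP/measurable_funTS; exact: measurable_normal_pdf.
rewrite EFinB fineK ?Nfin// -(@probability_setC _ _ _ N)//.
by rewrite setCitvl.
Qed.

Lemma Phi_tail_gt0 x : 0 < 1 - Phi x.
Proof.
rewrite -lte_fin Phi_tail.
(* On [x, x + 1] one has |y| <= m, so the density is at least the constant [c]. *)
pose m : R := `|x| + 1.
pose c : R := normal_peak 1 * expR (- m ^+ 2 / 2).
have c0 : 0 < c by rewrite mulr_gt0 ?expR_gt0// normal_peak_gt0.
have xx1 : (x < x + 1)%R by rewrite ltrDl.
apply: (@lt_le_trans _ _ (\int[mu]_(y in `[x, (x + 1)%R]) c%:E)%E).
  rewrite integral_cst//= lebesgue_measure_itv/= lte_fin xx1 -EFinD addrAC subrr add0r.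
  by rewrite mule1 lte_fin.
apply: (@le_trans _ _ (\int[mu]_(y in `[x, (x + 1)%R]) (phi y)%:E)%E).
  apply: ge0_le_integral => //.
  - by move=> y _; rewrite lee_fin ltW.
  - by apply/measurable_EFinP/measurable_funTS; exact: measurable_normal_pdf.
  move=> y /=; rewrite in_itv/= => /andP[xy yx]; rewrite lee_fin normal_pdfE//.
  rewrite ler_pM2l ?normal_peak_gt0// /normal_fun ler_expR subr0 expr1n !mulNr lerN2.
  rewrite ler_pM2r ?invr_gt0//.
  rewrite -(real_normK (num_real y)) lerXn2r ?nnegrE ?addr_ge0//.
  rewrite /m ler_norml.
  have := ler_norm x; have := ler_norm (- x); rewrite normrN => h1 h2.
  by apply/andP; split; lra.
apply: ge0_subset_integral => //.
- by apply/measurable_EFinP/measurable_funTS; exact: measurable_normal_pdf.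
- by move=> y _; rewrite lee_fin normal_pdf_ge0.
- by move=> y /=; rewrite !in_itv/= andbT => /andP[].
Qed.

(** After the substitution y -> y + e, it suffices that phi (y + e) = exp (- e y - e^2 / 2) phi y <=
    exp (- e x) phi y for y >= x. This is the only tail asymptotics behind the extreme quantiles. *)
Lemma Phi_tail_shift x e : 0 <= e ->
  1 - Phi (x + e) <= expR (- (e * x)) * (1 - Phi x).
Proof.
move=> e0; rewrite -lee_fin EFinM !Phi_tail.
have mphi (D : set (measurableTypeR R)) : measurable_fun D (fun y => (phi y)%:E).
  by apply/measurable_EFinP/measurable_funTS; exact: measurable_normal_pdf.
pose F (y : R) := y + e.
have dF (y : R) : is_derive y (1 : R) F 1.
  by apply: is_derive_eq; rewrite addr0.
have F'E : F^`()%classic = cst 1.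
  by apply/funext => y; rewrite derive1E derive_val.
have cF : continuous F.
  by move=> y; apply/differentiable_continuous/derivable1_diffP.
rewrite -[x + e]/(F x) increasing_ge0_integration_by_substitutiony//.
- have -> : ((expR (- (e * x)))%:E * \int[mu]_(y in `[x, +oo[) (phi y)%:E =
      \int[mu]_(y in `[x, +oo[) (expR (- (e * x)) * phi y)%:E)%E.
    under [RHS]eq_integral do rewrite EFinM.
    by rewrite ge0_integralZl// => y _; rewrite lee_fin normal_pdf_ge0.
  rewrite F'E; apply: ge0_le_integral => //.
  + by move=> y _; rewrite lee_fin mulr_ge0//= normal_pdf_ge0.
  + apply/measurable_EFinP/measurable_funM => //.
    apply: measurableT_comp; first exact: measurable_normal_pdf.
    exact: measurable_funTS (continuous_measurable_fun cF).
  + apply/measurable_EFinP/measurable_funM => //.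
    by apply: measurable_funTS; exact: measurable_normal_pdf.
  move=> y /=; rewrite in_itv/= andbT => xy; rewrite lee_fin [leLHS]mulr1.
  rewrite !normal_pdfE// [leRHS]mulrCA; apply: ler_wpM2l; first exact: normal_peak_ge0.
  rewrite /normal_fun -expRD ler_expR !subr0 expr1n /F.
  rewrite [leLHS](_ : _ = - (e * y) - e ^+ 2 / 2 - y ^+ 2 / 2); last by field.
  rewrite [leRHS](_ : _ = - (e * x) - y ^+ 2 / 2); last by field.
  have := sqr_ge0 e; have := ler_wpM2l e0 xy; lra.
- by move=> y z _ _ yz; rewrite /F ltrD2r.
- by rewrite F'E => y _; exact: cvg_cst.
- by rewrite F'E; exact: is_cvg_cst.
- by rewrite F'E; exact: is_cvg_cst.
- by split; [move=> y _; exact: ex_derive|apply: cvg_at_right_filter; exact: cF].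
- exact: cvg_addrr.
- apply: continuous_subspaceT; exact: continuous_normal_pdf.
- by move=> y _; exact: normal_pdf_ge0.
Qed.

(** The identity under the standard normal law has [Phi] as distribution function, which provides
    the limits of [Phi] at both infinities. *)
Let idR : {RV N >-> R} :=
  HB.pack (idfun : measurableTypeR R -> R)
    (@isMeasurableFun.Build _ _ (measurableTypeR R) R idfun (@measurable_id _ _ setT)).

Lemma Phi_surj p : 0 < p < 1 -> exists x, Phi x = p.
Proof.
move=> /andP[p0 p1].
have [a Pa] : exists a, Phi a < p.
  have /fine_cvgP[_ /(cvgr_lt 0)/(_ _ p0)/filter_ex[a Pa]] := cvg_cdfNy0 idR.
  by exists a.
have [b Pb] : exists b, p < Phi b.
  have /fine_cvgP[_ /(cvgr_gt 1)/(_ _ p1)/filter_ex[b Pb]] := cvg_cdfy1 idR.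
  by exists b.
have ab : a <= b.
  by rewrite leNgt; apply/negP => /ltW /Phi_nondecreasing; rewrite leNgt (lt_trans Pa).
have [||c _ <-] := @IVT R (@Phi R) a b p ab.
- by apply: continuous_subspaceT; exact: continuous_Phi.
- by rewrite ge_min le_max (ltW Pa) (ltW Pb) orbT.
- by exists c.
Qed.

Lemma Phi_invK p : 0 < p < 1 -> Phi (Phi_inv p) = p.
Proof. by move=> /Phi_surj; exact: getPex. Qed.

End Phi_theory.

(** * Decomposition of the true nulls *)

Section correlation_mean0.
Context d (T : measurableType d) (R : realType) (P : probability T R).
Implicit Types X Y : {RV P >-> R}.

Lemma integrable_mul X Y :
  P.-integrable setT (EFin \o (fun w => X w ^+ 2)) ->
  P.-integrable setT (EFin \o (fun w => Y w ^+ 2)) ->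
  P.-integrable setT (EFin \o (fun w => X w * Y w)).
Proof.
move=> iX iY; apply: (le_integrable measurableT _ _ (integrableD measurableT iX iY)).
  by apply/measurable_EFinP; exact: measurable_funM.
move=> w _; rewrite -EFinD lee_fin normrM (le_trans _ (ler_norm _))//.
rewrite -(real_normK (num_real (X w))) -(real_normK (num_real (Y w))).
have := normr_ge0 (X w); have := normr_ge0 (Y w); nra.
Qed.

Let fine_covariance0 X Y : \int[P]_w X w = 0 -> \int[P]_w Y w = 0 ->
  fine (covariance P X Y) = \int[P]_w (X w * Y w).
Proof.
move=> X0 Y0; rewrite unlock unlock -/(Rintegral P setT X) -/(Rintegral P setT Y) X0 Y0.
congr fine; apply: eq_integral => w _.
by rewrite -[X in X%:E]/((X w - 0) * (Y w - 0)) !subr0.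
Qed.

Lemma correlation_mean0 X Y : has_gaussian_law P 0 1 X -> has_gaussian_law P 0 1 Y ->
  \int[P]_w (X w * Y w) = correlation X Y.
Proof.
move=> /gaussian_law_moments[_ _ X0 X1] /gaussian_law_moments[_ _ Y0 Y1].
rewrite /correlation /variance !fine_covariance0//.
have sqE (Z : T -> R) : \int[P]_w (Z w * Z w) = \int[P]_w (Z w ^+ 2) by [].
by rewrite !sqE X1 Y1 expr0n/= expr1n add0r sqrtr1 mulr1 divr1.
Qed.

End correlation_mean0.

(** * Linear combinations of equicorrelated variables *)

Section equicorrelated.
Context d (T : measurableType d) (R : realType) (P : probability T R).
Context (X : nat -> {RV P >-> R}) (rho : R) (n : nat) (I0 : {set 'I_n}).
Hypothesis X_gaussian : jointly_gaussian X.
Hypothesis iX : forall i, P.-integrable setT (EFin \o X i).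
Hypothesis iX2 : forall i, P.-integrable setT (EFin \o (fun w => X i w ^+ 2)).
Hypothesis EX : forall i, i \in I0 -> \int[P]_w X i w = 0.
Hypothesis EXX : forall i j, i \in I0 -> j \in I0 ->
  \int[P]_w (X i w * X j w) = rho + (1 - rho) * (i == j)%:R.

Let measurable_lincomb (a : 'I_n -> R) :
  measurable_fun [set: T] (fun w => \sum_(i < n) a i * X i w).
Proof. by apply: measurable_sum => i; exact: measurable_funM. Qed.

Definition lincomb (a : 'I_n -> R) : {RV P >-> R} :=
  HB.pack (fun w => \sum_(i < n) a i * X i w)
    (isMeasurableFun.Build _ _ _ _ _ (measurable_lincomb a)).

(** The quadratic form is the variance of the combination under the covariance matrix with 1 on the
    diagonal and [rho] elsewhere. Coefficients vanishing off [I0] keep the nonzero means out, and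
    [gaussian_law_identify] concludes. *)
Lemma lincomb_law (a : 'I_n -> R) (t : R) :
  (forall i, i \notin I0 -> a i = 0) -> 0 <= t ->
  (1 - rho) * (\sum_(i < n) a i ^+ 2) + rho * (\sum_(i < n) a i) ^+ 2 = t ^+ 2 ->
  has_gaussian_law P 0 t (lincomb a).
Proof.
move=> a0 t0 Qa; have [m [s [s0 law]]] := X_gaussian a.
apply: (@gaussian_law_identify _ _ _ _ (lincomb a) m s t s0 t0 law).
  have iaX i : P.-integrable setT (EFin \o (fun w => a i * X i w)).
    exact: (integrableZl measurableT (a i) (iX i)).
  have [_ ->] := Rintegral_sum (index_enum 'I_n) predT iaX.
  rewrite big1// => i _; rewrite (RintegralZl _ measurableT (iX i)).
  by have [/EX ->|/a0 ->] := boolP (i \in I0); rewrite ?mulr0 ?mul0r.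
have iXX i j := integrable_mul (iX2 i) (iX2 j).
have iaXX i j : P.-integrable setT (EFin \o (fun w => a i * a j * (X i w * X j w))).
  exact: (integrableZl measurableT (a i * a j) (iXX i j)).
have E1 i := Rintegral_sum (index_enum 'I_n) predT (iaXX i).
have [_ E2] := Rintegral_sum (index_enum 'I_n) predT (fun i => (E1 i).1).
transitivity (\int[P]_w (\sum_(i < n) \sum_(j < n) (a i * a j * (X i w * X j w)))).
  apply: eq_Rintegral => w _; rewrite expr2 big_distrlr/=.
  by apply: eq_bigr => i _; apply: eq_bigr => j _; ring.
rewrite E2 -Qa.
transitivity (\sum_(i < n) \sum_(j < n)
    ((1 - rho) * (a i * a j * (i == j)%:R) + rho * (a i * a j))).
  apply: eq_bigr => i _; rewrite (E1 i).2; apply: eq_bigr => j _.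
  rewrite (RintegralZl _ measurableT (iXX i j)).
  have [iI0|/a0 ->] := boolP (i \in I0); last by rewrite !mul0r !mulr0 addr0.
  have [jI0|/a0 ->] := boolP (j \in I0); last by rewrite !(mulr0, mul0r) addr0.
  by rewrite EXX//; ring.
under eq_bigr do rewrite big_split /= -!mulr_sumr.
rewrite big_split /= -!mulr_sumr; congr (_ * _ + _ * _).
  apply: eq_bigr => i _; rewrite (bigD1 i)//= eqxx mulr1 big1 ?addr0// => j ji.
  by rewrite eq_sym (negbTE ji) mulr0.
by rewrite expr2 mulr_suml.
Qed.

Notation m := (#|I0|%:R : R).

Let coef (i j : 'I_n) (r s g : R) (l : 'I_n) : R :=
  r * (l == i)%:R + s * (l == j)%:R - g * (l \in I0)%:R.

Let sum_delta (i : 'I_n) : \sum_(l < n) (l == i)%:R = 1 :> R.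
Proof. by rewrite (bigD1 i)//= eqxx big1 ?addr0// => l /negbTE ->. Qed.

Let sum_null : \sum_(l < n) (l \in I0)%:R = m.
Proof.
by rewrite -sum1_card natr_sum [RHS]big_mkcond; apply: eq_bigr => l _; case: ifP.
Qed.

(** The two brackets are the sum of squares and the sum of the coefficients r 1_i + s 1_j - g 1_I0.
    The alternative s = 0 allows i = j, so that the same lemma covers a single variable and the bare
    sum. *)
Lemma three_term_law (i j : 'I_n) (r s g t : R) : i \in I0 -> j \in I0 ->
  (i != j) || (s == 0) -> 0 <= t ->
  (1 - rho) * (r ^+ 2 + s ^+ 2 - 2 * g * (r + s) + m * g ^+ 2) +
    rho * (r + s - m * g) ^+ 2 = t ^+ 2 ->
  exists2 Y : {RV P >-> R}, has_gaussian_law P 0 t Y &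
    forall w, Y w = r * X i w + s * X j w - g * \sum_(l in I0) X l w.
Proof.
move=> iI0 jI0 ijs t0 Qt; exists (lincomb (coef i j r s g)).
  apply: lincomb_law => //.
    move=> l lI0; rewrite /coef (negbTE lI0).
    have /negbTE -> : l != i by apply: contraNneq lI0 => ->.
    have /negbTE -> : l != j by apply: contraNneq lI0 => ->.
    by rewrite !mulr0 subr0 addr0.
  rewrite -Qt; congr (_ * _ + _ * _ ^+ 2); last first.
    by rewrite /coef sumrB big_split/= -!mulr_sumr !sum_delta sum_null; ring.
  transitivity (\sum_(l < n) ((r ^+ 2 - 2 * g * r) * (l == i)%:R +
      (s ^+ 2 - 2 * g * s) * (l == j)%:R + g ^+ 2 * (l \in I0)%:R)).
    apply: eq_bigr => l _; rewrite /coef.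
    have [->|li] := eqVneq l i.
      rewrite iI0; case/orP: ijs => [/negbTE ->|/eqP ->]; last first.
        by case: (_ == _) => /=; ring.
      by rewrite /=; ring.
    have [->|lj] := eqVneq l j; first by rewrite jI0 /=; ring.
    by case: (_ \in _) => /=; ring.
  by rewrite !big_split/= -!mulr_sumr !sum_delta sum_null; ring.
move=> w /=; rewrite /coef.
have -> : \sum_(l in I0) X l w = \sum_(l < n) (l \in I0)%:R * X l w.
  by rewrite big_mkcond; apply: eq_bigr => l _; case: ifP; rewrite ?mul1r ?mul0r.
under eq_bigr do rewrite mulrBl mulrDl -!mulrA.
rewrite sumrB big_split/= -!mulr_sumr.
have dX (k : 'I_n) : \sum_(l < n) (l == k)%:R * X l w = X k w.
  by rewrite (bigD1 k)//= eqxx mul1r big1 ?addr0// => l /negbTE ->; rewrite mul0r.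
by rewrite !dX.
Qed.

Hypothesis rho_gt0 : 0 < rho.
Hypothesis rho_lt1 : rho < 1.
Hypothesis I0_gt0 : (0 < #|I0|)%N.

(* With A the mean of the null X_i and v its variance, X_i - w A and X_j - w A
   are uncorrelated exactly when w = 1 - sqrt (1 - rho / v); then w A has
   standard deviation [common_scale]. *)
Definition common_scale : R :=
  Num.sqrt (rho + (1 - rho) / m) - Num.sqrt ((1 - rho) / m).

Let m_gt0 : 0 < m. Proof. by rewrite ltr0n. Qed.

Let m_neq0 : m != 0. Proof. by rewrite gt_eqF. Qed.

Let sg := Num.sqrt (1 - rho).
Let sg_gt0 : 0 < sg. Proof. by rewrite sqrtr_gt0 subr_gt0. Qed.

Let sg_neq0 : sg != 0. Proof. by rewrite gt_eqF. Qed.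

Let sg2 : sg ^+ 2 = 1 - rho. Proof. by rewrite sqr_sqrtr// subr_ge0 ltW. Qed.

Let v := rho + (1 - rho) / m.
Let dm_gt0 : 0 < (1 - rho) / m. Proof. by rewrite divr_gt0// subr_gt0. Qed.

Let v_gt0 : 0 < v. Proof. by rewrite addr_gt0. Qed.

Let sv := Num.sqrt v.
Let sv_neq0 : sv != 0. Proof. by rewrite gt_eqF// sqrtr_gt0. Qed.

Let sv2 : sv ^+ 2 = v. Proof. by rewrite sqr_sqrtr// ltW. Qed.

(** This is sqrt (1 - rho / v), so 1 - K is the weight given to the mean of the nulls. *)
Let K := Num.sqrt ((1 - rho) / m) / sv.

Let K2 : K ^+ 2 * (m - sg ^+ 2 * m + sg ^+ 2) = sg ^+ 2.
Proof.
have -> : m - sg ^+ 2 * m + sg ^+ 2 = m * v by rewrite sg2 /v; field.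
have v_neq0 : v != 0 by rewrite gt_eqF.
rewrite /K expr_div_n sqr_sqrtr ?(ltW dm_gt0)// sv2 sg2.
by field; rewrite m_neq0 v_neq0.
Qed.

(** The left side is the variance of r Z_i + s Z_j, where Z_i is X_i minus 1 - K times the null
    mean, divided by [sg]. Its value r^2 + s^2 encodes unit variances and zero covariance at once;
    the cross terms cancel by [K2]. *)
Let quadratic_form (r s : R) :
  (1 - rho) * ((r / sg) ^+ 2 + (s / sg) ^+ 2 -
     2 * ((r + s) * (1 - K) / (sg * m)) * (r / sg + s / sg) +
     m * ((r + s) * (1 - K) / (sg * m)) ^+ 2) +
  rho * (r / sg + s / sg - m * ((r + s) * (1 - K) / (sg * m))) ^+ 2 =
  r ^+ 2 + s ^+ 2.
Proof.
have -> : rho = 1 - sg ^+ 2 by rewrite sg2; ring.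
transitivity (r ^+ 2 + s ^+ 2 + (r + s) ^+ 2 *
    (K ^+ 2 * (m - sg ^+ 2 * m + sg ^+ 2) - sg ^+ 2) / (m * sg ^+ 2)).
  by field; rewrite m_neq0 sg_neq0.
by rewrite K2 subrr mulr0 mul0r addr0.
Qed.

(** The joint characteristic function comes from a single variable: a1 Z_i + a2 Z_j is t times a
    standard normal variable, with t^2 = a1^2 + a2^2. *)
Lemma null_decomposition : exists (U : {RV P >-> R}) (Z : 'I_n -> {RV P >-> R}),
  [/\ has_gaussian_law P 0 1 U,
      forall i, i \in I0 -> has_gaussian_law P 0 1 (Z i),
      forall i w, i \in I0 ->
        X i w = Num.sqrt (1 - rho) * Z i w - common_scale * U w &
      forall i j, i \in I0 -> j \in I0 -> i != j -> forall a1 a2 b : R,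
        \int[P]_w cos (a1 * Z i w + a2 * Z j w + b) =
        cos b * expR (- (a1 ^+ 2 + a2 ^+ 2) / 2)].
Proof.
have [i0 i0I] : exists i, i \in I0 by apply/card_gt0P.
(* The null mean has variance [v], so dividing the null sum by m sv standardises it; [i0] only fills
   the two slots with coefficient 0. *)
have [U lawU UE] : exists2 U : {RV P >-> R}, has_gaussian_law P 0 1 U &
    forall w, U w = 0 * X i0 w + 0 * X i0 w - (m * sv)^-1 * \sum_(l in I0) X l w.
  apply: three_term_law; rewrite ?eqxx ?orbT//.
  transitivity (((1 - rho) / m + rho) / sv ^+ 2).
    by field; rewrite m_neq0 sv_neq0.
  by rewrite sv2 addrC -/v divff ?expr1n// gt_eqF.
pose c := (1 - K) / (sg * m).
have /choice[Z ZP] : forall i, exists Zi : {RV P >-> R}, i \in I0 ->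
    has_gaussian_law P 0 1 Zi /\
    forall w, Zi w = sg^-1 * X i w - c * \sum_(l in I0) X l w.
  move=> i; have [iI0|_] := boolP (i \in I0); last by exists (X 0%N).
  have [Zi lawZi ZiE] : exists2 Y : {RV P >-> R}, has_gaussian_law P 0 1 Y &
      forall w, Y w = 1 / sg * X i w + 0 / sg * X i w
        - (1 + 0) * (1 - K) / (sg * m) * \sum_(l in I0) X l w.
    apply: three_term_law => //; first by rewrite mul0r (eqxx (0 : R)) orbT.
    by rewrite quadratic_form expr0n/= addr0.
  exists Zi => _; split=> // w.
  by rewrite ZiE mul0r mul0r addr0 mul1r addr0 mul1r.
exists U, Z; split => //.
- by move=> i /ZP[].
- move=> i w iI0; have [_ ->] := ZP i iI0; rewrite UE -/sg /c /K /common_scale -/v -/sv.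
  by field; rewrite m_neq0 sv_neq0 sg_neq0.
- move=> i j iI0 jI0 ij a1 a2 b.
  have [_ ZiE] := ZP i iI0; have [_ ZjE] := ZP j jI0.
  (* The case a1 = a2 = 0 is separate because the other one divides by [t]. *)
  have [/eqP a0|t0] := eqVneq (a1 ^+ 2 + a2 ^+ 2) 0.
    move: (a0); rewrite paddr_eq0 ?sqr_ge0// !sqrf_eq0 => /andP[/eqP a10 /eqP a20].
    rewrite (eqP a0) oppr0 mul0r expR0 mulr1 a10 a20.
    under eq_Rintegral do rewrite !mul0r !add0r.
    rewrite (_ : (fun=> cos b) = cst (cos b))// Rintegral_cst//.
    have -> : fine (P [set: T]) = 1 by rewrite probability_setT.
    exact: mulr1.
  pose t := Num.sqrt (a1 ^+ 2 + a2 ^+ 2).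
  have tt : t ^+ 2 = a1 ^+ 2 + a2 ^+ 2 by rewrite sqr_sqrtr// addr_ge0 ?sqr_ge0.
  have tn0 : t != 0 by rewrite -sqrf_eq0 tt.
  have [Y lawY YE] : exists2 Y : {RV P >-> R}, has_gaussian_law P 0 1 Y &
      forall w, Y w = a1 / t / sg * X i w + a2 / t / sg * X j w
        - (a1 / t + a2 / t) * (1 - K) / (sg * m) * \sum_(l in I0) X l w.
    apply: three_term_law => //; first by rewrite ij.
    by rewrite quadratic_form !expr_div_n -mulrDl tt divff ?expr1n.
  rewrite -tt -(cos_normal_law t b lawY); apply: eq_Rintegral => w _.
  congr (cos (_ + b)); rewrite YE ZiE ZjE /c.
  by field; rewrite m_neq0 sg_neq0 tn0.
Qed.

End equicorrelated.

(** * Probability of many exceedances *)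

Section standard_normal_rv.
Context d (T : measurableType d) (R : realType) (P : probability T R).
Context (Y : {RV P >-> R}).
Hypothesis Y_law : has_gaussian_law P 0 1 Y.

Let gaussian01 (A : set R) : gaussian_law 0 1 A = normal_prob (0 : R) 1 A.
Proof. by rewrite /gaussian_law oner_eq0. Qed.

Lemma std_normal_le (y : R) : fine (P [set w | Y w <= y]) = Phi y.
Proof. by rewrite /Phi -gaussian01 -Y_law. Qed.

Lemma std_normal_gt (y : R) : fine (P [set w | y < Y w]) = 1 - Phi y.
Proof.
have -> : [set w | y < Y w] = ~` [set w | Y w <= y].
  by apply/seteqP; split => w /=; rewrite ltNge => /negP.
have mle := measurable_rv_le Y y.
rewrite probability_setC// fineB//; last exact: fin_num_measure.
by rewrite std_normal_le.
Qed.

(** The right side does not depend on [Y], so all standard normal variables share one expectation,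
    as the second moment method requires. *)
Lemma half_step_std_normal (t : R) :
  \int[P]_w half_step t (Y w) =
  \int[@lebesgue_measure R]_x (half_step t x * normal_pdf 0 1 x).
Proof.
have mh := measurable_half_step t.
have [||_ ->] := @integral_normal_law _ _ _ _ _ 0 1 _ Y_law _ mh => //.
apply: (le_integrable measurableT _ _ (@integrable_normal_pdf R 0 1)).
  by apply/measurable_EFinP/measurable_funM => //; exact: measurable_normal_pdf.
move=> x _; rewrite lee_fin normrM ler_piMl// ger0_norm ?half_step_ge0//.
exact: half_step_le1.
Qed.

Lemma half_step_tail (t : R) : 1 - Phi t <= \int[P]_w half_step t (Y w).
Proof.
have mgt := measurable_rv_gt Y t.
have iB : P.-integrable setT (EFin \o (\1_[set w | t < Y w] : T -> R)).
  exact: integrable_indic.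
have mh : measurable_fun setT (fun w => half_step t (Y w)).
  by apply: measurableT_comp => //; exact: measurable_half_step.
have ih : P.-integrable setT (EFin \o (fun w => half_step t (Y w))).
  apply: (@bounded_measurable_integrable _ _ _ P _ 1 mh) => w.
  by rewrite ger0_norm ?half_step_ge0 ?half_step_le1.
rewrite -std_normal_gt -[leLHS]/(fine (P _)).
have -> : fine (P [set w | t < Y w]) = \int[P]_w (\1_[set w | t < Y w] w : R).
  by rewrite /Rintegral integral_indic// setIT.
apply: (le_Rintegral _ iB ih) => // w _.
rewrite indicE; have [/set_mem/= tY|_] := boolP (w \in _); last exact: half_step_ge0.
by rewrite /half_step gtr0_sg ?subr_gt0//; lra.
Qed.

End standard_normal_rv.

Lemma fine_measure_bigsetU_le d (T : measurableType d) (R : realType)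
    (P : probability T R) (I : Type) (r : seq I) (Q : pred I) (B : I -> set T) :
  (forall i, measurable (B i)) ->
  fine (P (\big[setU/set0]_(i <- r | Q i) B i)) <=
  \sum_(i <- r | Q i) fine (P (B i)).
Proof.
move=> mB; elim: r => [|i r IH]; first by rewrite !big_nil measure0.
rewrite !big_cons; case: ifP => // Qi.
have mU : measurable (\big[setU/set0]_(j <- r | Q j) B j) by exact: bigsetU_measurable.
apply: le_trans (lerD (lexx _) IH).
rewrite -lee_fin EFinD !fineK ?fin_num_measure//; last exact: measurableU.
exact: measureU2.
Qed.

Section exceedance_bounds.
Context d (T : measurableType d) (R : realType) (P : probability T R).
Context (X : nat -> {RV P >-> R}) (n k : nat) (I0 : {set 'I_n}).
Context (U : {RV P >-> R}) (Z : 'I_n -> {RV P >-> R}) (s tau q b e : R).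
Hypothesis U_law : has_gaussian_law P 0 1 U.
Hypothesis Z_law : forall i, i \in I0 -> has_gaussian_law P 0 1 (Z i).
Hypothesis XE : forall (i : 'I_n) w, i \in I0 -> X i w = s * Z i w - tau * U w.
Hypothesis Z_charf : forall i j, i \in I0 -> j \in I0 -> i != j ->
  forall a1 a2 b : R, \int[P]_w cos (a1 * Z i w + a2 * Z j w + b) =
    cos b * expR (- (a1 ^+ 2 + a2 ^+ 2) / 2).
Hypothesis s_gt0 : 0 < s.
Hypothesis tau_gt0 : 0 < tau.
Hypothesis e_gt0 : 0 < e.

Let E := [set w | (k <= #|I0 :&: threshold_procedure X n (s * q - b)%R w|)%N].

Lemma measurable_exceedance (c : R) :
  measurable [set w | (k <= #|I0 :&: threshold_procedure X n c w|)%N].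
Proof.
have -> : [set w | (k <= #|I0 :&: @threshold_procedure _ T R P X n c w|)%N] =
    [set w | (k <= #|[set i in I0 | (c < X i w)%R]%SET|)%N].
  apply/seteqP; split => w /=; 
    rewrite (_ : _ :&: _ = [set i in I0 | (c < X i w)%R]%SET)//;
    by apply/setP => i; rewrite !inE.
apply: (@measurable_card_ge _ _ R) => i; exact: measurable_rv_gt.
Qed.

(** As k >= 1, the event yields a null with s Z_i - tau U > s q - b. Either Z_i > q + e, handled by
    the union bound, or tau U < b + s e. *)
Lemma exceedance_upper : (0 < k)%N ->
  fine (P E) <= Phi ((b + s * e) / tau) + #|I0|%:R * (1 - Phi (q + e)).
Proof.
move=> k0.
pose A := [set w | U w <= (b + s * e) / tau].
pose B (i : 'I_n) := [set w | q + e < Z i w].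
have mE : measurable E by exact: measurable_exceedance.
have mA : measurable A by exact: measurable_rv_le.
have mB i : measurable (B i) by exact: measurable_rv_gt.
have mBB : measurable (\big[setU/set0]_(i in I0) B i) by exact: bigsetU_measurable.
have EAB : E `<=` A `|` \big[setU/set0]_(i in I0) B i.
  move=> w; rewrite /E /= => /(leq_trans k0)/card_gt0P[i].
  rewrite !inE => /andP[iI0]; rewrite XE// => Xc.
  have [Zq|Zq] := leP (Z i w) (q + e).
    left; rewrite /A/= ler_pdivlMr//.
    have : s * Z i w <= s * (q + e) by rewrite ler_pM2l.
    lra.
  by right; rewrite (bigD1 i)//=; left.
rewrite -lee_fin fineK ?fin_num_measure//.
apply: (@le_trans _ _ (P (A `|` \big[setU/set0]_(i in I0) B i))).
  by apply: le_measure; rewrite ?inE//; exact: measurableU.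
apply: (le_trans (measureU2 _ mA mBB)).
rewrite EFinD -(std_normal_le U_law) fineK ?fin_num_measure//; apply: leeD => //.
rewrite -[leLHS]fineK ?fin_num_measure//.
rewrite lee_fin (le_trans (fine_measure_bigsetU_le P _ _ mB))// mulr_natl -sumr_const.
by apply: ler_sum => i iI0; rewrite (std_normal_gt (Z_law iI0)).
Qed.

(** If tau U <= b - s e and Z_i >= q - e / 2, then X_i >= s q - b + s e / 2. Halving [e] on the side
    of Z_i leaves the slack that makes the rejection strict. *)
Lemma exceedance_lower (p := 1 - Phi (q - e / 2)) :
  2 * k%:R <= #|I0|%:R * p -> (0 < #|I0|)%N ->
  Phi ((b - s * e) / tau) <= fine (P E) + 4 / (#|I0|%:R * p).
Proof.
move=> kp I00.
pose A := [set w | U w <= (b - s * e) / tau].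
pose F := [set w | (k <= #|[set i in I0 | (q - e / 2 <= Z i w)%R]%SET|)%N].
have mE : measurable E by exact: measurable_exceedance.
have mA : measurable A by exact: measurable_rv_le.
have mF : measurable F.
  by apply: (@measurable_card_ge _ _ R) => i; exact: measurable_rv_ge.
have AEF : A `<=` E `|` ~` F.
  move=> w Aw; have [Fw|] := pselect (F w); last by right.
  left; apply: leq_trans Fw _; apply: fintype.subset_leq_card.
  apply/fintype.subsetP => i.
  rewrite !inE => /andP[iI0 Zq]; rewrite iI0/= XE//.
  have : U w * tau <= b - s * e by rewrite -ler_pdivlMr.
  have : s * (q - e / 2) <= s * Z i w by rewrite ler_pM2l.
  have := mulr_gt0 s_gt0 e_gt0; lra.
(* Chebyshev's bound is obtained for the common mean [p'] of the half-steps and then weakened to the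
   Gaussian tail p <= p'. *)
pose p' := \int[@lebesgue_measure R]_x (half_step (q - e / 2) x * normal_pdf 0 1 x).
have EZ i : i \in I0 -> \int[P]_w half_step (q - e / 2) (Z i w) = p'.
  by move=> iI0; rewrite half_step_std_normal//; exact: Z_law.
have pp' : p <= p'.
  have /card_gt0P[i iI0] := I00.
  by rewrite -(EZ i iI0); exact/half_step_tail/Z_law.
have cZ i j : i \in I0 -> j \in I0 -> i != j ->
    uncorrelated (Z i) (Z j) (half_step (q - e / 2)) (half_step (q - e / 2)).
  by move=> iI0 jI0 ij; apply: half_step_uncorrelated; exact: Z_charf.
have m0 : 0 < #|I0|%:R :> R by rewrite ltr0n.
have p0 : 0 < p by exact: Phi_tail_gt0.
have mpp : #|I0|%:R * p <= #|I0|%:R * p' by rewrite ler_pM2l.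
have := few_exceedances_le EZ cZ (le_trans kp mpp) (lt_le_trans (mulr_gt0 m0 p0) mpp).
rewrite -/F => Fle.
rewrite -(std_normal_le U_law); apply: (@le_trans _ _ (fine (P E) + fine (P (~` F)))).
  have mcF : measurable (~` F) by exact: measurableC.
  rewrite -lee_fin EFinD !fineK ?fin_num_measure//.
  apply: (@le_trans _ _ (P (E `|` ~` F))).
    by apply: le_measure; rewrite ?inE//; exact: measurableU.
  exact: measureU2.
rewrite lerD2l (le_trans Fle)// ler_pM2l// lef_pV2 ?posrE ?mulr_gt0//.
exact: lt_le_trans pp'.
Qed.

End exceedance_bounds.

(** * Extreme quantiles and the tails near them *)

Section extreme_quantiles.
Context {R : realType}.

Definition extreme_quantile (n : nat) : R := Phi_inv (1 - n%:R^-1).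

Notation q := extreme_quantile.

Lemma Phi_extreme_quantile (n : nat) : (1 < n)%N -> 1 - Phi (q n) = n%:R^-1.
Proof.
move=> n1; rewrite Phi_invK ?subKr//.
have n0 : 0 < n%:R :> R by rewrite ltr0n ltnW.
rewrite subr_gt0 invf_lt1// ltr1n n1/=.
by rewrite ltrBlDr ltrDl invr_gt0.
Qed.

Lemma extreme_quantile_cvgy : q n @[n --> \oo] --> +oo.
Proof.
apply/cvgryPge => M; near=> n.
rewrite leNgt; apply/negP => /ltW /Phi_nondecreasing; rewrite -lerN2 -(lerD2l 1).
rewrite Phi_extreme_quantile; last by near: n; exact: nbhs_infty_gt.
apply/negP; rewrite -ltNge invf_plt ?posrE ?Phi_tail_gt0//; last first.
  by rewrite ltr0n; near: n; exact: nbhs_infty_gt.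
by near: n; exact: nbhs_infty_gtr.
Unshelve. all: end_near. Qed.

(** Since the tail at q_n is 1 / n, [Phi_tail_shift] bounds the product by exp (- e q_n). *)
Lemma Phi_tail_right_cvg0 (e : R) : 0 < e ->
  n%:R * (1 - Phi (q n + e)) @[n --> \oo] --> (0 : R).
Proof.
move=> e0.
have ey : e * q n @[n --> \oo] --> +oo.
  apply/cvgryPge => A; near=> n; rewrite -ler_pdivrMl//.
  by near: n; move: (_^-1 * A); apply/cvgryPge; exact: extreme_quantile_cvgy.
have c0 : expR (- (e * q n)) @[n --> \oo] --> (0 : R).
  exact: (cvg_comp _ _ ey (@cvgr_expR R)).
apply: squeeze_cvgr (cvg_cst 0) c0.
near=> n; have n1 : (1 < n)%N by near: n; exact: nbhs_infty_gt.
have n0 : 0 < n%:R :> R by rewrite ltr0n ltnW.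
rewrite mulr_ge0 ?(ltW n0) ?(ltW (Phi_tail_gt0 _))//=.
rewrite mulrC -ler_pdivlMr//.
by rewrite -(Phi_extreme_quantile n1); apply: Phi_tail_shift; exact: ltW.
Unshelve. all: end_near. Qed.

(** [Phi_tail_shift] started from q_n - e ends at q_n, where the tail is 1 / n; hence the product is
    at least exp (e (q_n - e)) >= e (q_n - e). *)
Lemma Phi_tail_left_cvgy (e : R) : 0 < e ->
  n%:R * (1 - Phi (q n - e)) @[n --> \oo] --> +oo.
Proof.
move=> e0; apply: (@ger_cvgy _ _ _ _ (fun n => e * (q n - e))).
  near=> n; have n1 : (1 < n)%N by near: n; exact: nbhs_infty_gt.
  have n0 : 0 < n%:R :> R by rewrite ltr0n ltnW.
  have := Phi_tail_shift (q n - e) (ltW e0).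
  rewrite subrK (Phi_extreme_quantile n1) expRN -ler_pdivrMl ?invr_gt0 ?expR_gt0//.
  rewrite invrK ler_pdivrMr// [leRHS]mulrC; apply: le_trans.
  by apply: le_trans (expR_ge1Dx _); rewrite lerDr.
apply/cvgryPge => A; near=> n; rewrite -ler_pdivrMl// lerBrDr.
by near: n; move: (_ + e); apply/cvgryPge; exact: extreme_quantile_cvgy.
Unshelve. all: end_near. Qed.

End extreme_quantiles.

(** * Limit of the k-FWER *)

Lemma kFWER_fin_num d (T : measurableType d) (R : realType) (P : probability T R)
    (X : nat -> {RV P >-> R}) (n k : nat) (I0 : {set 'I_n}) (c : R) :
  kFWER P k I0 (threshold_procedure X n c) \is a fin_num.
Proof. by apply: fin_num_measure; exact: measurable_exceedance. Qed.

Lemma common_scale_cvg (R : realType) (rho : R) (I0 : forall n, {set 'I_n}) :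
  0 < rho -> rho < 1 -> #|I0 n|%:R @[n --> \oo] --> (+oo : set_system R) ->
  common_scale rho (I0 n) @[n --> \oo] --> Num.sqrt rho.
Proof.
move=> rho0 rho1 moo.
have m0 : (1 - rho) / #|I0 n|%:R @[n --> \oo] --> (0 : R).
  rewrite -[X in _ --> X](mulr0 (1 - rho)); apply: cvgMr.
  apply/gtr0_cvgV0 => //.
  by near=> n; near: n; exact: cvgry_gt.
have c0 : rho + (1 - rho) / #|I0 n|%:R @[n --> \oo] --> rho.
  by rewrite -[X in _ --> X](addr0 rho); apply: cvgD => //; exact: cvg_cst.
have c1 : Num.sqrt (rho + (1 - rho) / #|I0 n|%:R) @[n --> \oo] --> Num.sqrt rho.
  exact: (cvg_comp _ _ c0 (@sqrt_continuous R rho)).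
have c2 : Num.sqrt ((1 - rho) / #|I0 n|%:R) @[n --> \oo] --> Num.sqrt 0.
  exact: (cvg_comp _ _ m0 (@sqrt_continuous R 0)).
have -> : Num.sqrt rho = Num.sqrt rho - Num.sqrt 0 by rewrite sqrtr0 subr0.
exact: cvgB.
Unshelve. all: end_near. Qed.

Theorem theorem6p1 (R : realType) (d : measure_display) (T : measurableType d)
    (P : probability T R) (rho alpha : R) (k : nat)
    (mu : nat -> R) (X : nat -> {RV P >-> R})
    (rho_gt0 : 0 < rho) (rho_lt1 : rho < 1)
    (alpha_gt0 : 0 < alpha) (alpha_lt1 : alpha < 1)
    (k_ge1 : (1 <= k)%N)
    (mu_ge0 : forall i, 0 <= mu i)
    (X_jointly_gaussian : jointly_gaussian X)
    (X_law : forall i, has_gaussian_law P (mu i) 1 (X i))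
    (X_corr : forall i j, i != j -> correlation (X i) (X j) = rho)
    (n0_cvg : cvg ((fun n => #|true_nulls mu n|%:R / n%:R : R) @ \oo))
    (n0_lim : 0 < lim ((fun n => #|true_nulls mu n|%:R / n%:R : R) @ \oo)) :
  kFWER P k (true_nulls mu n) (threshold_procedure X n (cutoff n alpha rho))
    @[n --> \oo] --> alpha%:E.
Proof.
pose I0 n := true_nulls mu n.
pose m n : R := #|I0 n|%:R.
pose q := @extreme_quantile R.
pose s := Num.sqrt (1 - rho).
pose z := Phi_inv alpha.
pose tau n := common_scale rho (I0 n).
pose a n := fine (kFWER P k (I0 n) (threshold_procedure X n (cutoff n alpha rho))).
have s_gt0 : 0 < s by rewrite sqrtr_gt0 subr_gt0.
have sr_gt0 : 0 < Num.sqrt rho by rewrite sqrtr_gt0.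
have Phiz : Phi z = alpha by rewrite Phi_invK ?alpha_gt0.
pose C := normal_peak (1 : R).
have C_gt0 : 0 < C by exact: normal_peak_gt0.
set L := lim _ in n0_lim; have mL : m n / n%:R @[n --> \oo] --> L by exact: n0_cvg.
(* The positive limit [L] makes the number of true nulls comparable to n, so both tail limits
   transfer from n to [m n]. *)
have m_ge : \forall n \near \oo, L / 2 * n%:R <= m n.
  near=> n; have n0 : 0 < n%:R :> R by rewrite ltr0n; near: n; exact: nbhs_infty_gt.
  rewrite -ler_pdivlMr//; near: n; apply: (cvgr_ge L) => //; lra.
have m_le n : m n <= n%:R by rewrite ler_nat -[X in (_ <= X)%N]card_ord max_card.
have moo : m n @[n --> \oo] --> +oo.
  apply/cvgryPge => A; near=> n; apply: (@le_trans _ _ (L / 2 * n%:R)).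
    rewrite -ler_pdivrMl ?divr_gt0//; near: n; exact: nbhs_infty_ger.
  by near: n.
have tau_cvg : tau n @[n --> \oo] --> Num.sqrt rho by exact: common_scale_cvg.
have tail_upper e : 0 < e -> m n * (1 - Phi (q n + e)) @[n --> \oo] --> (0 : R).
  move=> e0; apply: squeeze_cvgr (cvg_cst 0) (Phi_tail_right_cvg0 e0).
  near=> n; have t0 := Phi_tail_gt0 (q n + e).
  by rewrite mulr_ge0 ?(ltW t0)//= ler_pM2r.
have tail_lower e : 0 < e -> m n * (1 - Phi (q n - e)) @[n --> \oo] --> +oo.
  move=> e0; apply/cvgryPge => A.
  have /cvgryPge ty := Phi_tail_left_cvgy e0.
  near=> n; have t0 := Phi_tail_gt0 (q n - e).
  apply: (@le_trans _ _ (L / 2 * (n%:R * (1 - Phi (q n - e))))).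
    by rewrite -ler_pdivrMl ?divr_gt0//; near: n; exact: ty.
  by rewrite mulrA ler_pM2r//; near: n.
have EX2 i := gaussian_law_moments (X_law i).
have iX i : P.-integrable setT (EFin \o X i) by have [] := EX2 i.
have iX2 i : P.-integrable setT (EFin \o (fun w => X i w ^+ 2)) by have [] := EX2 i.
have law0 n (i : 'I_n) : i \in I0 n -> has_gaussian_law P 0 1 (X i).
  by rewrite inE => /eqP <-; exact: X_law.
have EX n (i : 'I_n) : i \in I0 n -> \int[P]_w X i w = 0.
  by move=> /law0 /gaussian_law_moments[].
have EXX n (i j : 'I_n) : i \in I0 n -> j \in I0 n ->
    \int[P]_w (X i w * X j w) = rho + (1 - rho) * (i == j)%:R.
  move=> iI jI; have [<-|ij] := eqVneq i j.
    have [_ _ _] := gaussian_law_moments (law0 _ _ iI).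
    by rewrite expr0n/= expr1n add0r mulr1 addrC subrK => <-.
  by rewrite mulr0 addr0 (correlation_mean0 (law0 _ _ iI) (law0 _ _ jI)) X_corr.
(* With b = sqrt rho z the cutoff is s q_n - b, the form used in the exceedance bounds. *)
have bounds e : 0 < e -> \forall n \near \oo,
    a n <= Phi ((Num.sqrt rho * z + s * e) / tau n) + m n * (1 - Phi (q n + e)) /\
    Phi ((Num.sqrt rho * z - s * e) / tau n) <=
      a n + 4 / (m n * (1 - Phi (q n - e / 2))).
  move=> e0; near=> n.
  have I0_gt0 : (0 < #|I0 n|)%N.
    by rewrite -(ltr_nat R); near: n; exact: cvgry_gt.
  have tau_gt0 : 0 < tau n by near: n; apply: (cvgr_gt (Num.sqrt rho)).
  have [U [Z [U_law Z_law XE Z_charf]]] := null_decomposition X_jointly_gaussian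
    iX iX2 (@EX n) (@EXX n) rho_gt0 rho_lt1 I0_gt0.
  split.
    exact: (exceedance_upper (q n) (Num.sqrt rho * z) e U_law Z_law XE
      s_gt0 tau_gt0 k_ge1).
  apply: (@exceedance_lower _ _ _ _ _ _ _ _ _ _ _ _ (q n) (Num.sqrt rho * z) e
    U_law Z_law XE Z_charf s_gt0 tau_gt0 e0) => //.
  near: n; apply: cvgry_ge; apply: tail_lower; exact: divr_gt0.
have -> : (fun n => kFWER P k (I0 n) (threshold_procedure X n (cutoff n alpha rho))) =
    (fun n => (a n)%:E).
  by apply/funext => n; rewrite fineK//; exact: kFWER_fin_num.
apply: cvg_EFin; first exact: nearW.
apply/cvgrPdist_le => eps eps0.
(* Chosen so that s e / sqrt rho = eps / (4 C) = eC, where [C] is a Lipschitz constant of [Phi]. *)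
pose e := eps * Num.sqrt rho / (4 * C * s).
have e0 : 0 < e by rewrite divr_gt0 ?mulr_gt0.
pose eC := eps / (4 * C).
have eC0 : 0 < eC by rewrite divr_gt0 ?mulr_gt0.
have y_cvg (c : R) :
    (Num.sqrt rho * z + c * (s * e)) / tau n @[n --> \oo] --> z + c * eC.
  have -> : z + c * eC = (Num.sqrt rho * z + c * (s * e)) / Num.sqrt rho.
    by rewrite /eC /e; field; rewrite !gt_eqF.
  by apply: cvgMr; apply: cvgV => //; rewrite gt_eqF.
(* The signs c = 1 and c = -1 serve the upper and the lower bound. The argument is within eC of its
   limit, itself at distance eC from z, so [Phi] moves by at most 2 C eC = eps / 2. *)
have Phi_near (c : R) : `|c| = 1 -> \forall n \near \oo,
    `|Phi z - Phi ((Num.sqrt rho * z + c * (s * e)) / tau n)| <= eps / 2.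
  move=> c1; near=> n; apply: le_trans (normr_PhiB_le _ _) _.
  rewrite -/C.
  have h : `|z + c * eC - (Num.sqrt rho * z + c * (s * e)) / tau n| <= eC.
    by near: n; move/cvgrPdist_le : (y_cvg c); exact.
  have h2 : `|z - (z + c * eC)| <= eC.
    by rewrite opprD addNKr normrN normrM c1 mul1r gtr0_norm.
  have h3 := ler_distD (z + c * eC) z ((Num.sqrt rho * z + c * (s * e)) / tau n).
  apply: (@le_trans _ _ (C * (eC + eC))); first by rewrite ler_pM2l//; lra.
  by rewrite /eC le_eqVlt; apply/orP; left; apply/eqP; field; rewrite gt_eqF.
have Pp := Phi_near 1 (normr1 _).
have Pm := Phi_near (-1) (normrN1 _).
near=> n.
have [bu bl] :
    a n <= Phi ((Num.sqrt rho * z + s * e) / tau n) + m n * (1 - Phi (q n + e)) /\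
    Phi ((Num.sqrt rho * z - s * e) / tau n) <=
      a n + 4 / (m n * (1 - Phi (q n - e / 2))) by near: n; exact: bounds.
have pp : `|Phi z - Phi ((Num.sqrt rho * z + 1 * (s * e)) / tau n)| <= eps / 2.
  by near: n.
have pm : `|Phi z - Phi ((Num.sqrt rho * z + -1 * (s * e)) / tau n)| <= eps / 2.
  by near: n.
rewrite mul1r in pp; rewrite mulN1r in pm.
(* The other half of [eps] goes to the probabilities of the exceptional events. *)
have tu : m n * (1 - Phi (q n + e)) <= eps / 2.
  by near: n; apply: (cvgr_le 0); [exact: tail_upper|exact: divr_gt0].
have tl : 4 / (m n * (1 - Phi (q n - e / 2))) <= eps / 2.
  have big : 8 / eps <= m n * (1 - Phi (q n - e / 2)).
    by near: n; apply: cvgry_ge; apply: tail_lower; exact: divr_gt0.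
  rewrite ler_pdivrMr; last by apply: lt_le_trans big; rewrite divr_gt0.
  rewrite mulrC -ler_pdivrMr ?divr_gt0//.
  by rewrite [leLHS](_ : _ = 8 / eps)//; field; rewrite gt_eqF.
move: pp pm; rewrite Phiz !ler_norml => /andP[pp1 pp2] /andP[pm1 pm2].
rewrite /=; move: (a n) (Phi _) (Phi _) (m n * _) (4 / _) bu bl tu tl pp1 pp2 pm1 pm2.
by move=> ? ? ? ? ? ? ? ? ? ? ? ? ?; apply/andP; split; lra.
Unshelve. all: end_near. Qed.
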